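(* Let $G$ be a bounded domain in a real Hilbert space $H$, let $p\in G$, let $\Lambda\subset H$ be a real two-dimensional linear subspace, and write $p=p_\Lambda+p_\perp$ with $p_\Lambda\in\Lambda$, $p_\perp\perp\Lambda$, $a=|p_\Lambda|$, $b=|p_\perp|$. Assume that for some $c>0$ $$G\cap(p+\Lambda)=\{p_\perp+v:v\in\Lambda,\ |v|<c\},$$ and put $s=a/c$, $R^2=c^2+b^2$. Let $T=E_s^c$ on $\mathbb D$, a parametrization of this section. Then, for every $F=P[\Phi_F]\in\mathcal F_G^{\mathrm n}(p,\Lambda)$, $$I_s^c(\Phi_F)-(1+s^2)R^2=c\bigl(\|dF_0\|-\|dT_0\|\bigr).$$ Consequently, $$\|dF_0\|\le\|dT_0\|\iff I_s^c(\Phi_F)\le(1+s^2)R^2 .$$ In particular, the following conditions are equivalent: (i) $T$ is a directional extremal harmonic disk for $(G,p,\Lambda)$; (ii) $\sigma_G(p,\Lambda)=(1+s^2)R^2$; (iii) $I_s^c(\Phi_F)\le(1+s^2)R^2$ for every $F\in\mathcal F_G^{\mathrm n}(p,\Lambda)$.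
   Context: $\mathbb D$ is the open unit disk in $\mathbb C$, $\mathbb T=\partial\mathbb D$, $m$ is normalized Lebesgue measure on $\mathbb T$. A $C^2$ map $F:\mathbb D\to H$ is harmonic if $\Delta F=0$. For $\Phi\in L^1(\mathbb T,H)$ the (Bochner) Poisson integral is $P[\Phi](re^{i\theta})=\int_{\mathbb T}\frac{1-r^2}{1-2r\cos(\theta-t)+r^2}\Phi(e^{it})\,dm$. Every bounded harmonic $F:\mathbb D\to H$ has a unique (a.e.) boundary function $\Phi_F\in L^\infty(\mathbb T,H)$ with $F=P[\Phi_F]$. $\|dF_0\|$ is the operator norm of the real differential $dF_0:\mathbb R^2\to H$; a nonzero $dF_0$ is conformal if $|dF_0v|=\lambda|v|$ for all $v\in\mathbb R^2$, for some $\lambda>0$. $\mathcal F_G(p,\Lambda)$ is the set of harmonic maps $F:\mathbb D\to G$ with $F(0)=p$, $dF_0\neq0$ conformal, and $dF_0(\mathbb R^2)=\Lambda$; $M_G(p,\Lambda)=\sup\{\|dF_0\|:F\in\mathcal F_G(p,\Lambda)\}$; a member of $\mathcal F_G(p,\Lambda)$ attaining this supremum is called a directional extremal harmonic disk for $(G,p,\Lambda)$. Choose an orthonormal basis $e_1,e_2$ of $\Lambda$ with $p_\Lambda=ae_1$ ($e_1$ arbitrary if $a=0$). $\mathcal F_G^{\mathrm n}(p,\Lambda)$ is the set of $F\in\mathcal F_G(p,\Lambda)$ with $F_x(0)=\lambda e_1$, $F_y(0)=\lambda e_2$, $\lambda=\|dF_0\|>0$. For $0\le s<1$ let $\mathcal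 M_s(\zeta)=\frac{s+\zeta}{1+s\zeta}$, $w_s(z)=|1+sz|^2$, $E_s^c(\zeta)=p_\perp+c\operatorname{Re}\mathcal M_s(\zeta)e_1+c\operatorname{Im}\mathcal M_s(\zeta)e_2$ for $\zeta\in\overline{\mathbb D}$, and $$I_s^c(\Phi)=\int_{\mathbb T}w_s(z)\langle\Phi(z),E_s^c(z)\rangle\,dm(z).$$ Finally $\sigma_G(p,\Lambda)=\sup\{I_s^c(\Phi_F):F\in\mathcal F_G^{\mathrm n}(p,\Lambda)\}$. *)

(* Defs.v *)
From HB Require Import structures.
From mathcomp Require Import all_boot all_order all_algebra.
From mathcomp Require Import all_classical all_reals all_analysis.
From mathcomp Require Import complex.
Import Order.TTheory GRing.Theory Num.Theory.
Import numFieldNormedType.Exports.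

Set Implicit Arguments.
Unset Strict Implicit.
Unset Printing Implicit Defensive.

Local Open Scope classical_set_scope.
Local Open Scope ring_scope.
Local Open Scope complex_scope.

(* The complex plane enters in two guises: as the real normed module [R * R],
   on which maps into [H] are differentiated, and as the field [R[i]], used
   only for the algebra of the disk automorphisms.  The norm of [R * R] is the
   sup norm; it gives the usual topology and the usual derivatives, and the
   Euclidean norm is written out wherever the metric matters. *)

Section BochnerIntegral.
Context d (T : measurableType d) (R : realType)
  (mu : {finite_measure set T -> \bar R}) (H : normedModType R).

Definition simple_function (g : T -> H) : Prop :=
  finite_set (range g) /\ forall y : H, measurable (g @^-1` [set y]).

Definition simple_integral (g : T -> H) : H :=
  \sum_(y \in range g) fine (mu (g @^-1` [set y])) *: y.

Definition strongly_measurable (f : T -> H) : Prop :=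
  exists2 g : nat -> T -> H, (forall n, simple_function (g n)) &
    {ae mu, forall t, g n t @[n --> \oo] --> f t}.

(* [f] is Bochner integrable and its Bochner integral is [v]. *)
Definition is_bochner_integral (f : T -> H) (v : H) : Prop :=
  strongly_measurable f /\
  exists g : nat -> T -> H,
    [/\ forall n, simple_function (g n),
        (\int[mu]_t (`|f t - g n t|%:E))%E @[n --> \oo] --> 0%E &
        simple_integral (g n) @[n --> \oo] --> v].

Definition in_Linfty (f : T -> H) : Prop :=
  strongly_measurable f /\ exists M : R, {ae mu, forall t, `|f t| <= M}.

End BochnerIntegral.

Section Disk.
Context (R : realType).

Definition unit_disk : set (R * R) := [set z | z.1 ^+ 2 + z.2 ^+ 2 < 1].

Definition polar (r t : R) : R * R := (r * cos t, r * sin t).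

Definition cplx (z : R * R) : R[i] := z.1 +i* z.2.

Lemma two_pi_gt0 : 0 < 2 * pi :> R.
Proof. by rewrite mulr_gt0 ?pi_gt0. Qed.

(* Normalized Lebesgue measure on the unit circle, in the angle coordinate
   [t]: a function [f] on the circle is integrated as [f (polar 1 t)]. *)
Definition circle_measure : probability (measurableTypeR R) R := uniform_prob two_pi_gt0.

Definition mobius (s : R) (z : R[i]) : R[i] := (s%:C + z) / (1 + s%:C * z).

Definition weight (s : R) (z : R[i]) : R := ComplexField.Normc.normc (1 + s%:C * z) ^+ 2.

End Disk.

Section HarmonicDisks.
Context (R : realType) (H : normedModType R).
Implicit Types (F : R * R -> H) (G Lam : set H) (p : H).

(* [F] and all its first directional derivatives are Frechet differentiable,
   and all its second directional derivatives are continuous. *)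
Definition C2_on_disk F : Prop := forall z, unit_disk z ->
  [/\ differentiable F z,
      forall u, differentiable ('D_u F) z &
      forall u v, {for z, continuous ('D_u ('D_v F))}].

Definition partial_x F : R * R -> H := 'D_((1, 0) : R * R) F.
Definition partial_y F : R * R -> H := 'D_((0, 1) : R * R) F.

Definition laplacian F (z : R * R) : H :=
  partial_x (partial_x F) z + partial_y (partial_y F) z.

Definition harmonic_on_disk F : Prop :=
  C2_on_disk F /\ forall z, unit_disk z -> laplacian F z = 0.

Definition diff0 F : R * R -> H := 'd F (0 : R * R).

Definition eucl_norm (v : R * R) : R := Num.sqrt (v.1 ^+ 2 + v.2 ^+ 2).

Definition opnorm (L : R * R -> H) : R :=
  sup [set `|L v| | v in [set v | eucl_norm v <= 1]].

Definition conformal (L : R * R -> H) : Prop :=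
  exists2 lam : R, 0 < lam & forall v, `|L v| = lam * eucl_norm v.

(* The class F_G(p, Lam); values outside the disk are irrelevant. *)
Definition disk_class G p Lam F : Prop :=
  [/\ harmonic_on_disk F,
      forall z, unit_disk z -> G (F z),
      F 0 = p,
      conformal (diff0 F) &
      range (diff0 F) = Lam].

(* Suprema are taken in the extended reals, so that they are genuine suprema
   without any finiteness side condition. *)
Definition max_diff G p Lam : \bar R :=
  ereal_sup [set (opnorm (diff0 F))%:E | F in disk_class G p Lam].

Definition extremal_disk G p Lam F : Prop :=
  disk_class G p Lam F /\ (opnorm (diff0 F))%:E = max_diff G p Lam.

Definition normalized_class G p Lam (e1 e2 : H) F : Prop :=
  [/\ disk_class G p Lam F,
      0 < opnorm (diff0 F),
      partial_x F 0 = opnorm (diff0 F) *: e1 &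
      partial_y F 0 = opnorm (diff0 F) *: e2].

Definition poisson_kernel (r t : R) : R :=
  (1 - r ^+ 2) / (1 - 2 * r * cos t + r ^+ 2).

(* [Phi], a function on the unit circle, is in L^oo and [F = P[Phi]] on the
   disk, i.e. [Phi] represents the boundary function of [F]. *)
Definition boundary_function F (Phi : R * R -> H) : Prop :=
  in_Linfty (@circle_measure R) (fun t => Phi (polar 1 t)) /\
  forall r theta : R, 0 <= r < 1 ->
    is_bochner_integral (@circle_measure R)
      (fun t => poisson_kernel r (theta - t) *: Phi (polar 1 t))
      (F (polar r theta)).

(* E_s^c, with [q] the component of the base point orthogonal to the plane
   spanned by [e1, e2]. *)
Definition section_map (s c : R) (q e1 e2 : H) (z : R * R) : H :=
  q + (c * complex.Re (mobius s (cplx z))) *: e1 + (c * complex.Im (mobius s (cplx z))) *: e2.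

End HarmonicDisks.

Section HilbertSpace.
Context (R : realType) (H : normedModType R) (dot : {dot H for idfun}).
Implicit Types (G Lam : set H).

(* The norm of [H] is the one given by the inner product; a complete such [H]
   is a real Hilbert space. *)
Definition norm_from_dot : Prop := forall x : H, `|x| = Num.sqrt (dot x x).

Definition two_dim_subspace Lam : Prop := exists u v : H,
  (forall x y : R, x *: u + y *: v = 0 -> x = 0 /\ y = 0) /\
  Lam = [set w | exists x y : R, w = x *: u + y *: v].

Definition orthonormal_basis Lam (e1 e2 : H) : Prop :=
  [/\ dot e1 e1 = 1, dot e2 e2 = 1, dot e1 e2 = 0 &
      Lam = [set w | exists x y : R, w = x *: e1 + y *: e2]].

(* I_s^c *)
Definition functional_I (s c : R) (q e1 e2 : H) (Phi : R * R -> H) : R :=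
  \int[@circle_measure R]_t
    (weight s (cplx (polar 1 t)) *
     dot (Phi (polar 1 t)) (section_map s c q e1 e2 (polar 1 t))).

Definition sigma_G (s c : R) (q : H) G (p : H) Lam (e1 e2 : H) : \bar R :=
  ereal_sup [set x | exists F Phi,
    [/\ normalized_class G p Lam e1 e2 F,
        boundary_function F Phi &
        x = (functional_I s c q e1 e2 Phi)%:E]].

End HilbertSpace.

(* Main.v *)
Require Import Defs.
From HB Require Import structures.
From mathcomp Require Import all_boot all_order all_algebra.
From mathcomp Require Import all_classical all_reals all_analysis.
From mathcomp Require Import finmap measurable_realfun simple_functions complex ring lra.
Import Order.TTheory GRing.Theory Num.Theory.
Import numFieldNormedType.Exports.

(** Everything rests on one computation.  On the unit circle the product of the
    weight [w_s] with the section map [E_s^c] is a trigonometric polynomial of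
    degree one: with [z = e^(it)],
      [w_s(z) M_s(z) = 2 s + z + s^2 conj z] and [w_s(z) = 1 + s^2 + 2 s cos t].
    Hence [I_s^c(Phi)] only sees the Fourier coefficients of [Phi] of order zero
    and one.  If [F = P[Phi]], these coefficients are [F(0)] and half of the
    partial derivatives of [F] at the origin, because the Poisson kernel is
    [1 + 2 r cos t + O(r^2)].  For a normalized [F] all of them are known except
    the number [|dF_0|], which enters linearly with slope [c]; the remaining
    constants combine into the stated gap formula, [|dT_0|] being
    [c (1 - s^2)].  See [circle_coefficients], [functional_IE] and [gap_formula].

    The equivalences need two more facts.  First, [T] belongs to the class: it
    is a disk automorphism followed by an affine similarity, so it is
    harmonic and conformal at the origin, and it takes its values in the section
    ([section_disk_class]).  Second, the bound on [I_s^c] is assumed only for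
    maps that come with a boundary function, whereas extremality concerns all
    maps of the class.  Fatou's theorem is avoided by dilation: an arbitrary map
    of the class is first rotated or reflected into normalized position
    ([disk_class_normalize]) and then replaced by [z |-> F (rho z)] with
    [rho < 1].  This map is still in the class, its differential at the origin
    is [rho] times the original one, and it has a boundary function that is
    plainly its continuous restriction to the circle
    ([boundary_function_dilation]).  Letting [rho] tend to one gives the bound
    for [F]; applied to [T] it shows that the supremum [sigma_G] is at least
    [(1 + s^2) R^2].

    That the dilated map is the Poisson integral of its restriction to the
    circle is proved in weak form, for the scalar harmonic functions
    [z |-> <F z, h>], and lifted to [H] by approximating the boundary values
    with step functions.  The scalar Poisson formula comes from a homotopy: the
    integral against the Poisson kernel at [z0] of [u] along the circles that
    shrink from the unit circle to the point [z0] is constant, since its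
    derivative is the integral of the real part of a holomorphic function times
    [z] over the circle, which vanishes by Cauchy's theorem.  The gradient of a harmonic [u] is
    holomorphic because second derivatives commute. *)

Set Implicit Arguments.
Unset Strict Implicit.
Unset Printing Implicit Defensive.

Local Open Scope classical_set_scope.
Local Open Scope ring_scope.

(** * Integrals of functions that are measurable only almost everywhere *)

Section AlmostEverywhere.
Context d (T : measurableType d) (R : realType)
  (mu : {measure set T -> \bar R}).

Import HBNNSimple.

(** The circle measure is defined on Borel sets only, so a function that agrees
    almost everywhere with a measurable one may fail to be measurable.  The
    integral of a nonnegative function is a supremum over simple functions below
    it, and cutting such a simple function off on a null set does not change its
    integral; this gives monotonicity without any measurability. *)
Lemma ae_le_ge0_integral (f g : T -> \bar R) :
  (forall x, 0 <= f x)%E -> (forall x, 0 <= g x)%E ->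
  {ae mu, forall x, (f x <= g x)%E} ->
  (\int[mu]_x f x <= \int[mu]_x g x)%E.
Proof.
move=> f0 g0 [N [mN N0 fgN]].
rewrite [leLHS]ge0_integralTE// [leRHS]ge0_integralTE//.
apply: ge_ereal_sup => _ [h /= hf <-].
have mNC : measurable (~` N) by exact: measurableC.
pose h' := proj_nnsfun h mNC.
have -> : sintegral mu h = sintegral mu h'.
  have := integral_nnsfun mu measurableT h.
  have := integral_nnsfun mu measurableT h'.
  rewrite !patch_setT => <- <-; apply: ae_eq_integral => //.
  - exact/measurable_EFinP.
  - exact/measurable_EFinP.
  - exists N; split=> // x /= /not_implyP[_]; apply: contra_notP => Nx.
    by rewrite mindicE mem_set ?mulr1.
apply: ereal_sup_ubound; exists h' => //= x.
rewrite mindicE; case: (pselect (N x)) => Nx.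
  by rewrite memNset ?mulr0 ?lee_fin//; exact.
rewrite mem_set// mulr1 (le_trans (hf x))//.
by apply: contrapT => fg; apply: Nx; exact: fgN.
Qed.

Lemma ae_eq_ge0_integral (f g : T -> \bar R) :
  (forall x, 0 <= f x)%E -> (forall x, 0 <= g x)%E ->
  {ae mu, forall x, f x = g x} ->
  (\int[mu]_x f x = \int[mu]_x g x)%E.
Proof.
move=> f0 g0 fg; apply/eqP; rewrite eq_le; apply/andP; split;
  by apply: ae_le_ge0_integral => //; apply: filterS fg => x ->.
Qed.

Lemma ae_eq_Rintegral (f g : T -> R) :
  {ae mu, forall x, f x = g x} -> \int[mu]_x f x = \int[mu]_x g x.
Proof.
move=> fg; rewrite /Rintegral integralE [in RHS]integralE; congr (fine (_ - _)%E).
all: apply: ae_eq_ge0_integral => //; apply: filterS fg => x fgx.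
- by rewrite !funeposE fgx.
- by rewrite !funenegE fgx.
Qed.

End AlmostEverywhere.

Section BoundedIntegrable.
Context d (T : measurableType d) (R : realType)
  (mu : {finite_measure set T -> \bar R}).

Lemma bounded_integrable (f : T -> R) (M : R) :
  measurable_fun setT f -> (forall x, `|f x| <= M) ->
  mu.-integrable setT (EFin \o f).
Proof.
move=> mf fM; apply: measurable_bounded_integrable => //.
- rewrite -ge0_fin_numE//; exact: fin_num_measure.
- exists M; split; first exact: num_real.
  by move=> x Mx y _; exact: le_trans (fM y) (ltW Mx).
Qed.

Lemma integrable_addr (f g : T -> R) : mu.-integrable setT (EFin \o f) ->
  mu.-integrable setT (EFin \o g) ->
  mu.-integrable setT (EFin \o fun t => f t + g t).
Proof.
by move=> fi gi; rewrite /comp; under eq_fun do rewrite EFinD; exact: integrableD.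
Qed.

Lemma integrable_subr (f g : T -> R) : mu.-integrable setT (EFin \o f) ->
  mu.-integrable setT (EFin \o g) ->
  mu.-integrable setT (EFin \o fun t => f t - g t).
Proof.
by move=> fi gi; rewrite /comp; under eq_fun do rewrite EFinB; exact: integrableB.
Qed.

Lemma integrable_mulrl (k : R) (f : T -> R) : mu.-integrable setT (EFin \o f) ->
  mu.-integrable setT (EFin \o fun t => k * f t).
Proof.
by move=> fi; rewrite /comp; under eq_fun do rewrite EFinM; exact: integrableZl.
Qed.

End BoundedIntegrable.

Lemma normr_Rintegral_le_cst d (T : measurableType d) (R : realType)
    (P : probability T R) (f : T -> R) (B : R) :
  measurable_fun setT f -> (forall t, `|f t| <= B) -> `|\int[P]_t f t| <= B.
Proof.
move=> mf fB; have fi := bounded_integrable P mf fB.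
apply: (le_trans (le_normr_Rintegral _ _)) => //.
have PB : \int[P]_t (cst B t) = B.
  rewrite Rintegral_cst//; transitivity (B * fine (1%:E : \bar R)).
    by congr (_ * fine _); exact: probability_setT.
  by rewrite mulr1.
rewrite -[leRHS]PB; apply: le_Rintegral => //; first exact: integrable_norm.
by apply: (@bounded_integrable _ _ _ _ _ `|B|).
Qed.

(** * The inner product *)

Section InnerProduct.
Context (R : realType) (H : normedModType R) (dot : {dot H for idfun}).
Hypothesis Hdot : norm_from_dot dot.

Lemma dotC x y : dot x y = dot y x.
Proof. by rewrite hermC /= expr0 mul1r. Qed.

Lemma dotDl x y z : dot (x + y) z = dot x z + dot y z.
Proof. exact: linearDl. Qed.

Lemma dotZl k x y : dot (k *: x) y = k * dot x y.
Proof. exact: linearZl_LR. Qed.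

Lemma dotDr x y z : dot x (y + z) = dot x y + dot x z.
Proof. by rewrite dotC dotDl !(dotC _ x). Qed.

Lemma dotZr k x y : dot x (k *: y) = k * dot x y.
Proof. by rewrite dotC dotZl dotC. Qed.

Lemma dotBl x y z : dot (x - y) z = dot x z - dot y z.
Proof. exact: linearBl. Qed.

Lemma dotxx_ge0 x : 0 <= dot x x.
Proof. by have [->|x0] := eqVneq x 0; rewrite ?linear0l// ltW// neq0_dnorm_gt0. Qed.

Lemma dotxx x : dot x x = `|x| ^+ 2.
Proof. by rewrite Hdot sqr_sqrtr// dotxx_ge0. Qed.

Lemma normr_dot_le x y : `|dot x y| <= `|x| * `|y|.
Proof.
have [->|y0] := eqVneq y 0; first by rewrite dotC linear0l !normr0 mulr0.
rewrite -(@ler_pXn2r _ 2)// ?nnegrE ?mulr_ge0//.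
have y2 : 0 < dot y y by rewrite neq0_dnorm_gt0.
have := dotxx_ge0 (dot y y *: x - dot x y *: y).
rewrite dotBl !dotZl !(dotC _ (_ - _)) !dotBl !dotZl (dotC y x) => h.
have : 0 <= dot y y * (dot x x * dot y y - dot x y ^+ 2).
  by apply: le_trans h _; rewrite le_eqVlt; apply/orP; left; apply/eqP; ring.
by rewrite pmulr_rge0// subr_ge0 exprMn -!dotxx real_normK ?num_real.
Qed.

(** The functional [x |-> <x, h>], named so that it can carry a linear structure. *)
Definition dotr (h x : H) : R := dot x h.

Lemma dotr_is_linear h : linear (dotr h : H -> R^o).
Proof. by move=> k x y; rewrite /dotr dotDl dotZl. Qed.

HB.instance Definition _ h :=
  GRing.isLinear.Build R H R^o *:%R (dotr h) (dotr_is_linear h).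

Lemma dotr_continuous h : continuous (dotr h).
Proof.
move=> x; apply/cvgrPdist_lt => e e0; near=> y.
have h1 : 0 < `|h| + 1 by rewrite ltr_wpDl.
rewrite /dotr -dotBl (le_lt_trans (normr_dot_le _ _))//.
have : `|x - y| * (`|h| + 1) < e.
  by rewrite -ltr_pdivlMr//; near: y; apply: cvgr_dist_lt; rewrite ?divr_gt0.
by apply: le_lt_trans; rewrite ler_wpM2l// lerDl.
Unshelve. all: by end_near. Qed.

Lemma cvg_dotl {I} (F : set_system I) {FF : Filter F} (f : I -> H) x h :
  f @ F --> x -> dot (f i) h @[i --> F] --> dot x h.
Proof.
by move=> fx; apply: (@continuous_cvg _ _ _ _ _ _ (dotr h)) => //; exact: dotr_continuous.
Qed.

Lemma differentiable_dotl (V : normedModType R) (F : V -> H) h z :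
  differentiable F z -> differentiable (fun x => dot (F x) h) z.
Proof.
move=> dF; apply: (@differentiable_comp _ _ _ _ F (dotr h)) => //.
have := @linear_differentiable R H R^o (dotr h : {linear H -> R^o}) (F z).
by apply; exact: dotr_continuous.
Qed.

Lemma derive_dotl (V : normedModType R) (F : V -> H) h z v :
  derivable F z v -> 'D_v (fun x => dot (F x) h) z = dot ('D_v F z) h.
Proof.
move=> dF; apply: cvg_lim => //.
have dFh := cvg_dotl (h := h) dF.
have E : (fun t => dot (t^-1 *: ((F \o shift z) (t *: v) - F z)) h) =1
    fun t => t^-1 *: (dot (F (t *: v + z)) h - dot (F z) h).
  by move=> t; rewrite dotZl dotBl.
by move: dFh; rewrite (eq_cvg _ _ E); apply.
Qed.

End InnerProduct.

(** * Weak form of the Bochner integral *)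

Lemma cvge0_near_le (R : realType) (u : nat -> \bar R) (e : R) :
  u n @[n --> \oo] --> 0%E -> 0 < e -> \forall n \near \oo, (u n <= e%:E)%E.
Proof.
move=> /fine_cvgP[ufin u0] e0; near=> n.
have un : u n \is a fin_num by near: n.
rewrite -(fineK un) lee_fin; near: n.
exact: (cvgr_le 0).
Unshelve. all: by end_near. Qed.

Section SimpleFunctions.
Context d (T : measurableType d) (R : realType)
  (mu : {finite_measure set T -> \bar R}) (H : normedModType R).

(** Such a function is glued from finitely many pieces [phi^~ y], each on the
    measurable set where the simple function takes the value [y]. *)
Lemma measurable_fun_simple (g : T -> H) (phi : T -> H -> R) :
  simple_function g -> (forall y, measurable_fun setT (phi^~ y)) ->
  measurable_fun setT (fun t => phi t (g t)).
Proof.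
move=> [fg mg] mphi _ B mB.
rewrite setTI [X in measurable X](_ : _ =
  \bigcup_(y in range g) (g @^-1` [set y] `&` (phi^~ y) @^-1` B)).
  apply: fin_bigcup_measurable => // y _; apply: measurableI => //.
  by rewrite -[X in measurable X]setTI; exact: mphi.
apply/seteqP; split=> [t /= Bt|t [_ _ [/= <-]]//].
by exists (g t) => //; exists t.
Qed.

Lemma simple_function_bounded (g : T -> H) :
  simple_function g -> exists M : R, forall t, `|g t| <= M.
Proof.
move=> [/finite_seqP[s gs] _]; exists (\sum_(y <- s) `|y|) => t.
have : g t \in s by have : range g (g t) by []; rewrite gs.
elim: s {gs} => // y s IHs; rewrite inE big_cons => /predU1P[->|/IHs].
  by rewrite lerDl sumr_ge0.
by move/le_trans; apply; rewrite lerDr.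
Qed.

(** The function [w] is not assumed measurable, so the factor [k] cannot be
    pulled out of an integral of [k * w]; it is moved to the measurable side. *)
Lemma normr_Rintegral_le (u : T -> R) (w : T -> \bar R) (k e : R) :
  0 < k -> mu.-integrable setT (EFin \o u) -> (forall t, 0 <= w t)%E ->
  {ae mu, forall t, (`|u t|%:E <= k%:E * w t)%E} ->
  (\int[mu]_t w t <= e%:E)%E -> `|\int[mu]_t u t| <= k * e.
Proof.
move=> k0 iu w0 uw we.
apply: (le_trans (le_normr_Rintegral _ _)) => //.
have inu := integrable_norm iu.
rewrite -ler_pdivrMl// -RintegralZl//.
have ikn : mu.-integrable setT (EFin \o (fun t => k^-1 * `|u t|)).
  exact: integrable_mulrl.
rewrite -lee_fin fineK; last exact: integrable_fin_num.
apply: le_trans we; apply: ae_le_ge0_integral => //.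
  by move=> t; rewrite lee_fin mulr_ge0// invr_ge0 ltW.
apply: filterS uw => t ut.
by rewrite EFinM lee_pdivrMl.
Qed.

Variable dot : {dot H for idfun}.
Hypothesis Hdot : norm_from_dot dot.

Lemma dot_simple_integral (g : T -> H) (h : H) : simple_function g ->
  \int[mu]_t dot (g t) h = dot (simple_integral mu g) h.
Proof.
move=> [fg mg]; rewrite /simple_integral fsbig_finite//=.
pose c y t : R := \1_(g @^-1` [set y]) t.
have ic y k : mu.-integrable setT (EFin \o (fun t => c y t * k)).
  apply: (@bounded_integrable _ _ _ _ _ `|k|).
    by apply: measurable_funM => //; exact: measurable_indic.
  move=> t; rewrite normrM ger0_norm// ler_piMl// /c indicE.
  by case: (_ \in _).
have Ic y k : \int[mu]_t (c y t * k) = fine (mu (g @^-1` [set y])) * k.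
  rewrite RintegralZr//.
    by rewrite /Rintegral integral_indic// setIT.
  by have := ic y 1; rewrite /comp; under eq_fun do rewrite mulr1.
have Is (s : seq H) : mu.-integrable setT
      (EFin \o fun t => \sum_(y <- s) c y t * dot y h) /\
    \int[mu]_t (\sum_(y <- s) c y t * dot y h) =
    dot (\sum_(y <- s) fine (mu (g @^-1` [set y])) *: y) h.
  elim: s => [|y s [IH1 IH2]].
    rewrite /comp; under eq_fun do rewrite big_nil.
    split; first exact: integrable0.
    rewrite big_nil linear0l /Rintegral.
    by rewrite integral0_eq// => x _; rewrite big_nil.
  have E t : \sum_(z <- y :: s) c z t * dot z h =
     c y t * dot y h + \sum_(z <- s) c z t * dot z h by rewrite big_cons.
  split.
    rewrite (_ : (fun t => _) = fun t => c y t * dot y h +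
       \sum_(z <- s) c z t * dot z h); last by apply/funext => t; rewrite E.
    exact: integrable_addr.
  rewrite (@eq_Rintegral _ _ _ _ _
    (fun t => c y t * dot y h + \sum_(z <- s) c z t * dot z h)); last first.
    by move=> t _; rewrite E.
  by rewrite RintegralD// Ic IH2 big_cons dotDl dotZl.
have [_ <-] := Is (finmap.enum_fset (fset_set (range g))).
apply: eq_Rintegral => t _.
have gt : g t \in fset_set (range g) by rewrite in_fset_set//; apply: mem_set; exists t.
rewrite (bigD1_seq (g t))//= ?fset_uniq// big1 ?addr0.
  by rewrite /c indicE mem_set// mul1r.
by move=> y ygt; rewrite /c indicE memNset ?mul0r// => /= /esym/eqP; rewrite (negbTE ygt).
Qed.

(** Pairing with [h] turns a Bochner integral into a scalar one.  The scalar
    function is only required to agree with [<f t, h>] almost everywhere, since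
    the latter need not be measurable. *)
Lemma is_bochner_integral_dot (f : T -> H) (v h : H) (psi : T -> R) (M : R) :
  is_bochner_integral mu f v ->
  measurable_fun setT psi -> (forall t, `|psi t| <= M) ->
  {ae mu, forall t, psi t = dot (f t) h} ->
  \int[mu]_t psi t = dot v h.
Proof.
move=> [_ [g [sg g0 gv]]] mpsi psiM psif.
have ipsi := bounded_integrable mu mpsi psiM.
have mgh n : measurable_fun setT (fun t => dot (g n t) h).
  exact: (@measurable_fun_simple (g n) (fun _ y => dot y h)).
have igh n : mu.-integrable setT (EFin \o fun t => dot (g n t) h).
  have [Mn gMn] := simple_function_bounded (sg n).
  apply: (@bounded_integrable _ _ _ _ _ (Mn * `|h|)) => // t.
  by rewrite (le_trans (normr_dot_le Hdot _ _))// ler_wpM2r.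
have k0 : 0 < `|h| + 1 by rewrite ltr_wpDl.
have Sv : dot (simple_integral mu (g n)) h @[n --> \oo] --> dot v h.
  exact: (cvg_dotl Hdot gv).
rewrite -(cvg_lim _ Sv)//; apply/esym/cvg_lim => //.
apply/cvgrPdist_le => e e0; near=> n.
rewrite -dot_simple_integral// -RintegralB//.
have -> : e = (`|h| + 1) * (e / (`|h| + 1)) by rewrite mulrC divfK ?gt_eqF.
apply: (@normr_Rintegral_le _ (fun t => `|f t - g n t|%:E)) => //.
- exact: integrable_subr.
- apply: filterS psif => t ->.
  rewrite -dotBl -EFinM lee_fin (le_trans (normr_dot_le Hdot _ _))// mulrC.
  by rewrite ler_wpM2r// lerDl.
- by near: n; apply: cvge0_near_le => //; rewrite divr_gt0.
Unshelve. all: by end_near. Qed.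

(** The measurable representative is [<f t, h>] set to zero on a null set
    outside of which the approximating simple functions converge and the norm
    bound holds.  The bound [M] does not depend on [h]. *)
Lemma in_Linfty_dot (f : T -> H) : in_Linfty mu f ->
  exists M : R, forall h, exists psi : T -> R,
    [/\ measurable_fun setT psi, forall t, `|psi t| <= M * `|h| &
      {ae mu, forall t, psi t = dot (f t) h}].
Proof.
move=> [[g sg gf] [M fM]].
exists (Num.max 0 M) => h.
have [N [mN N0 fN]] : {ae mu, forall t, `|f t| <= M /\ g n t @[n --> \oo] --> f t}.
  by apply: filterS2 gf fM => t; split.
have {}fN t : ~ N t -> `|f t| <= M /\ g n t @[n --> \oo] --> f t.
  by move=> Nt; apply: contrapT => ft; apply: Nt; exact: fN.
exists (fun t => \1_(~` N) t * dot (f t) h); split.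
- apply: (@measurable_fun_cvg _ _ _ _ (fun n t => \1_(~` N) t * dot (g n t) h)).
    move=> n; apply: measurable_funM.
      by apply: measurable_indic; exact: measurableC.
    exact: (@measurable_fun_simple (g n) (fun _ y => dot y h)).
  move=> t _; rewrite indicE; case: (pselect (N t)) => Nt.
    rewrite memNset; last by move=> /(_ Nt).
    by rewrite mul0r; under eq_fun do rewrite mul0r; exact: cvg_cst.
  rewrite mem_set// mul1r; under eq_fun do rewrite mul1r.
  by apply: cvg_dotl => //; have [] := fN _ Nt.
- move=> t; rewrite indicE; case: (pselect (N t)) => Nt.
    rewrite memNset ?mul0r ?normr0; last by move=> /(_ Nt).
    by rewrite mulr_ge0// le_max lexx.
  rewrite mem_set// mul1r (le_trans (normr_dot_le Hdot _ _))// ler_wpM2r//.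
  by have [ftM _] := fN _ Nt; rewrite le_max ftM orbT.
- exists N; split => // t /=; apply: contra_notP => Nt.
  by rewrite indicE mem_set// mul1r.
Qed.

End SimpleFunctions.

(** * Fourier coefficients of a boundary function *)

Section CircleCoefficients.
Context (R : realType).
Notation mu := (@circle_measure R).

Lemma poisson_denominator_ge (r x : R) :
  0 <= r -> (1 - r) ^+ 2 <= 1 - 2 * r * cos x + r ^+ 2.
Proof. by move=> r0; have := cos_le1 x; nra. Qed.

Lemma poisson_denominator_gt0 (r x : R) :
  0 <= r < 1 -> 0 < 1 - 2 * r * cos x + r ^+ 2.
Proof.
move=> /andP[r0 r1]; apply: lt_le_trans (poisson_denominator_ge x r0).
by rewrite exprn_gt0// subr_gt0.
Qed.

(** First order expansion of the Poisson kernel at [r = 0], with an error that is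
    uniform in the angle.  For [r <= 1/2] the denominator is at least [1/4] and
    the numerator of the error at most [7 r], whence the constant. *)
Lemma poisson_kernel_expansion (r x : R) : 0 < r <= 2^-1 ->
  `|r^-1 * (poisson_kernel r x - 1) - 2 * cos x| <= 28 * r.
Proof.
move=> /andP[r0 r12].
have D0 : 0 < 1 - 2 * r * cos x + r ^+ 2.
  by apply: poisson_denominator_gt0; apply/andP; split; lra.
have c1 := cos_le1 x; have cN1 := cos_geN1 x.
have -> : r^-1 * (poisson_kernel r x - 1) - 2 * cos x =
    r * (4 * cos x ^+ 2 - 2 - 2 * r * cos x) / (1 - 2 * r * cos x + r ^+ 2).
  by rewrite /poisson_kernel; field; rewrite !gt_eqF.
rewrite !normrM normfV (gtr0_norm r0) (gtr0_norm D0) ler_pdivrMr//.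
rewrite (mulrC 28) -(mulrA r 28) ler_pM2l//.
have h : (1 - r) ^+ 2 <= 1 - 2 * r * cos x + r ^+ 2.
  by apply: poisson_denominator_ge; lra.
rewrite ler_norml; apply/andP; split; nra.
Qed.

Lemma continuous_poisson_kernel (r : R) : 0 <= r < 1 ->
  continuous (poisson_kernel r).
Proof.
move=> r01 t; rewrite /poisson_kernel.
apply: cvgM; first exact: cvg_cst.
apply: cvgV; first by rewrite gt_eqF// poisson_denominator_gt0.
apply: cvgD; last exact: cvg_cst.
apply: cvgB; first exact: cvg_cst.
by apply: cvgM; [exact: cvg_cst|exact: continuous_cos].
Qed.

Lemma poisson_kernel_bounds (r x : R) : 0 <= r < 1 ->
  0 <= poisson_kernel r x <= (1 - r ^+ 2) / (1 - r) ^+ 2.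
Proof.
move=> r01; have D0 := poisson_denominator_gt0 x r01.
case/andP: r01 => r0 r1.
have r2 : 0 <= 1 - r ^+ 2 by nra.
rewrite /poisson_kernel divr_ge0//=; last exact: ltW.
rewrite ler_wpM2l// lef_pV2 ?posrE ?exprn_gt0 ?subr_gt0//.
exact: poisson_denominator_ge.
Qed.

Lemma continuous_subl (theta : R) (f : R -> R) :
  continuous f -> continuous (fun t => f (theta - t)).
Proof.
move=> cf t; apply: (@continuous_comp _ _ _ (fun t => theta - t) f); last exact: cf.
by apply: cvgB; [exact: cvg_cst|exact: cvg_id].
Qed.

Context (H : normedModType R) (dot : {dot H for idfun}).
Hypothesis Hdot : norm_from_dot dot.
Variables (F Phi : R * R -> H).
Hypothesis FPhi : boundary_function F Phi.

(** Differentiating the Poisson representation at the origin in the direction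
    [theta] picks out the Fourier coefficient of order one, by
    [poisson_kernel_expansion].  One representative [psi] of [<Phi, h>] serves
    for all coefficients. *)
Lemma circle_coefficients (h : H) : differentiable F 0 ->
  exists psi : R -> R, exists M : R,
  [/\ measurable_fun setT psi, forall t, `|psi t| <= M,
      {ae mu, forall t, psi t = dot (Phi (polar 1 t)) h},
      \int[mu]_t psi t = dot (F 0) h &
      forall theta, \int[mu]_t (cos (theta - t) * psi t) =
        dot ('D_(polar 1 theta) F 0) h / 2].
Proof.
move=> dF; have [Phioo PF] := FPhi.
have [M0 /(_ h)[psi [mpsi psiM psiE]]] := in_Linfty_dot Hdot Phioo.
set M := M0 * `|h| in psiM.
have M_ge0 : 0 <= M by apply: le_trans (psiM 0).
have mcos theta : measurable_fun setT (fun t : R => cos (theta - t)).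
  apply: continuous_measurable_fun; apply: continuous_subl.
  exact: continuous_cos.
have mP r theta : 0 <= r < 1 ->
    measurable_fun setT (fun t : R => poisson_kernel r (theta - t)).
  move=> r01; apply: continuous_measurable_fun; apply: continuous_subl.
  exact: continuous_poisson_kernel.
have ib (k : R -> R) B : measurable_fun setT k -> (forall t, `|k t| <= B) ->
    mu.-integrable setT (EFin \o fun t => k t * psi t).
  move=> mk kB; apply: (@bounded_integrable _ _ _ _ _ (B * M)).
    exact: measurable_funM.
  by move=> t; rewrite normrM ler_pM.
have FE r theta : 0 <= r < 1 ->
    dot (F (polar r theta)) h = \int[mu]_t (poisson_kernel r (theta - t) * psi t).
  move=> r01; apply/esym.
  apply: (is_bochner_integral_dot Hdot (PF r theta r01)
     (M := (1 - r ^+ 2) / (1 - r) ^+ 2 * M)).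
  - by apply: measurable_funM => //; exact: mP.
  - move=> t; have /andP[P0 PB] := poisson_kernel_bounds (theta - t) r01.
    by rewrite normrM ler_pM// ger0_norm.
  - by apply: filterS psiE => t ->; rewrite dotZl.
have F0 : \int[mu]_t psi t = dot (F 0) h.
  have := FE 0 0; rewrite lexx ltr01 /polar !mul0r => /(_ isT) ->.
  apply: eq_Rintegral => t _; rewrite /poisson_kernel.
  by rewrite expr0n/= mulr0 mul0r !subr0 addr0 divr1 mul1r.
exists psi, M; split => // theta.
pose q r := r^-1 * (dot (F (polar r theta)) h - dot (F 0) h).
have dFh : q r @[r --> 0^'+] --> dot ('D_(polar 1 theta) F 0) h.
  apply: cvg_dnbhs_at_right.
  have := cvg_dotl Hdot (h := h) (diff_derivable (v := polar 1 theta) dF).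
  have qE r : dot (r^-1 *: ((F \o shift 0) (r *: polar 1 theta) - F 0)) h = q r.
    rewrite dotZl dotBl /= addr0 /q; congr (_ * (dot (F _) h - _)).
    by rewrite /polar !mul1r.
  by rewrite (eq_cvg _ _ qE); exact.
pose I := \int[mu]_t (cos (theta - t) * psi t).
have dI : q r @[r --> 0^'+] --> 2 * I.
  have M1 : 0 < 28 * (M + 1) by rewrite mulr_gt0// ltr_wpDl.
  apply/cvgrPdist_le => e e0; near=> r.
  have r0 : 0 < r by near: r; exact: nbhs_right_gt.
  have r12 : r <= 2^-1 by near: r; apply: nbhs_right_le; rewrite invr_gt0.
  have r01 : 0 <= r < 1 by apply/andP; split; lra.
  pose k t := r^-1 * (poisson_kernel r (theta - t) - 1) - 2 * cos (theta - t).
  have mk : measurable_fun setT k.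
    apply: measurable_funB; apply: measurable_funM => //.
    by apply: measurable_funB => //; exact: mP.
  have kB t : `|k t| <= 28 * r by apply: poisson_kernel_expansion; rewrite r0.
  have ipsi : mu.-integrable setT (EFin \o psi) by exact: bounded_integrable psiM.
  have icos : mu.-integrable setT (EFin \o fun t => cos (theta - t) * psi t).
    by apply: (ib _ 1) => // t; rewrite ler_norml cos_geN1 cos_le1.
  have iP : mu.-integrable setT
      (EFin \o fun t => poisson_kernel r (theta - t) * psi t).
    apply: (ib _ ((1 - r ^+ 2) / (1 - r) ^+ 2)); first exact: mP.
    move=> t; have /andP[P0 PB] := poisson_kernel_bounds (theta - t) r01.
    by rewrite ger0_norm.
  have -> : q r = \int[mu]_t (k t * psi t) + 2 * I.
    have ik : mu.-integrable setT (EFin \o fun t => k t * psi t) by exact: ib kB.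
    have i2cos := integrable_mulrl 2 icos.
    rewrite -RintegralZl// -RintegralD//.
    rewrite /q FE// -F0 -RintegralB// -RintegralZl//; last exact: integrable_subr.
    by apply: eq_Rintegral => t _; rewrite /k; ring.
  rewrite opprD addrCA subrr addr0 normrN.
  apply: (@le_trans _ _ (28 * r * M)).
    apply: normr_Rintegral_le_cst; first exact: measurable_funM.
    by move=> t; rewrite normrM ler_pM.
  have : r * (28 * (M + 1)) <= e.
    by rewrite -ler_pdivlMr//; near: r; apply: nbhs_right_le; rewrite divr_gt0.
  by apply: le_trans; nra.
have := cvg_lim (@norm_hausdorff _ R) dI.
rewrite (cvg_lim (@norm_hausdorff _ R) dFh) => ->.
by rewrite mulrC mulKf.
Unshelve. all: by end_near. Qed.

End CircleCoefficients.

(** * The functional I *)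

Section MobiusFormulas.
Context (R : realType).
Local Open Scope complex_scope.

Lemma weightE (s : R) (z : R * R) :
  weight s (cplx z) = (1 + s * z.1) ^+ 2 + (s * z.2) ^+ 2.
Proof.
rewrite /weight /cplx /ComplexField.Normc.normc /=.
rewrite sqr_sqrtr ?addr_ge0 ?sqr_ge0//; ring.
Qed.

Lemma mobiusE (s : R) (z : R * R) : weight s (cplx z) != 0 ->
  mobius s (cplx z) =
   (((s + z.1) * (1 + s * z.1) + s * z.2 ^+ 2) / weight s (cplx z)) +i*
   ((1 - s ^+ 2) * z.2 / weight s (cplx z)).
Proof.
rewrite weightE => w0; set rhs := RHS.
rewrite /mobius /cplx /GRing.inv /GRing.mul /=; simpc; rewrite {}/rhs.
by apply/eqP; rewrite eq_complex /=; apply/andP; split; apply/eqP; field.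
Qed.

End MobiusFormulas.

Section FunctionalI.
Context (R : realType) (H : normedModType R) (dot : {dot H for idfun}).
Hypothesis Hdot : norm_from_dot dot.
Notation mu := (@circle_measure R).

Lemma weight_gt0 (s : R) (z : R * R) : 0 <= s < 1 -> z.1 ^+ 2 + z.2 ^+ 2 <= 1 ->
  0 < weight s (cplx z).
Proof.
move=> s01 z1; rewrite weightE ltr_wpDr ?sqr_ge0// exprn_gt0//.
have := sqr_ge0 z.2; nra.
Qed.

Lemma polar1_norm (t : R) : (polar 1 t).1 ^+ 2 + (polar 1 t).2 ^+ 2 = 1.
Proof. by rewrite /polar !mul1r cos2Dsin2. Qed.

(** Multiplication by the weight clears the denominator of the disk
    automorphism; on the unit circle this leaves a trigonometric polynomial of
    degree one. *)
Lemma weight_dot_section (s c : R) (q e1 e2 x : H) (t : R) : 0 <= s < 1 ->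
  weight s (cplx (polar 1 t)) *
    dot x (section_map s c q e1 e2 (polar 1 t)) =
  ((1 + s ^+ 2) * dot x q + 2 * s * (cos t * dot x q)) +
  (2 * s * c * dot x e1 + (1 + s ^+ 2) * c * (cos t * dot x e1) +
  (1 - s ^+ 2) * c * (sin t * dot x e2)).
Proof.
move=> s01; have z1 := polar1_norm t.
have w0 : 0 < weight s (cplx (polar 1 t)) by apply: weight_gt0; rewrite ?z1.
rewrite /section_map mobiusE ?gt_eqF//= !dotDr !dotZr.
have wE : weight s (cplx (polar 1 t)) =
    1 + 2 * s * cos t + s ^+ 2 * (cos t ^+ 2 + sin t ^+ 2).
  by rewrite weightE /polar /=; ring.
have nE : (s + 1 * cos t) * (1 + s * (1 * cos t)) + s * (1 * sin t) ^+ 2 =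
    s + (1 + s ^+ 2) * cos t + s * (cos t ^+ 2 + sin t ^+ 2) by ring.
rewrite nE; rewrite cos2Dsin2 in wE *.
move: wE w0; set w := weight _ _ => wE w0.
rewrite [LHS](_ : _ = w * dot x q + c * (s + (1 + s ^+ 2) * cos t + s * 1) * dot x e1 +
   c * ((1 - s ^+ 2) * sin t) * dot x e2); last by field; rewrite gt_eqF.
by rewrite wE; ring.
Qed.

(** The functional only involves the Fourier coefficients of order at most one,
    so it is determined by the value and the differential of [F] at the origin. *)
Lemma functional_IE (F Phi : R * R -> H) (s c : R) (q e1 e2 : H) :
  boundary_function F Phi -> differentiable F 0 -> 0 <= s < 1 ->
  functional_I dot s c q e1 e2 Phi =
    (1 + s ^+ 2) * dot (F 0) q + s * dot (partial_x F 0) q +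
    (2 * s * c * dot (F 0) e1 + (1 + s ^+ 2) * c * (dot (partial_x F 0) e1 / 2) +
    (1 - s ^+ 2) * c * (dot (partial_y F 0) e2 / 2)).
Proof.
move=> FPhi dF s01; rewrite /functional_I.
have Dx : 'D_(polar 1 0) F 0 = partial_x F 0.
  by rewrite /polar cos0 sin0 mulr1 mulr0.
have Dy : 'D_(polar 1 (pi / 2)) F 0 = partial_y F 0.
  by rewrite /polar cos_pihalf sin_pihalf mulr1 mulr0.
have [pq [Mq [mq bq Eq Iq0 Iq]]] := circle_coefficients Hdot FPhi q dF.
have [p1 [M1 [m1 b1 E1 I10 I1]]] := circle_coefficients Hdot FPhi e1 dF.
have [p2 [M2 [m2 b2 E2 I20 I2]]] := circle_coefficients Hdot FPhi e2 dF.
have c0 (t : R) : cos (0 - t) = cos t by rewrite sub0r cosN.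
have cp (t : R) : cos (pi / 2 - t) = sin t by rewrite -opprB cosN cosBpihalf.
have mcos theta : measurable_fun setT (fun t : R => cos (theta - t)).
  apply: continuous_measurable_fun; apply: continuous_subl.
  exact: continuous_cos.
have ib (psi : R -> R) M theta : measurable_fun setT psi ->
    (forall t, `|psi t| <= M) ->
    mu.-integrable setT (EFin \o fun t => cos (theta - t) * psi t).
  move=> mp pM; apply: (@bounded_integrable _ _ _ _ _ (1 * M)).
    by apply: measurable_funM => //; exact: mcos.
  by move=> t; rewrite normrM ler_pM// ler_norml cos_geN1 cos_le1.
have iq := bounded_integrable mu mq bq; have i1 := bounded_integrable mu m1 b1.
transitivity (\int[mu]_t (
  ((1 + s ^+ 2) * pq t + 2 * s * (cos (0 - t) * pq t)) +
  (2 * s * c * p1 t + (1 + s ^+ 2) * c * (cos (0 - t) * p1 t) +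
  (1 - s ^+ 2) * c * (cos (pi / 2 - t) * p2 t)))).
  apply: ae_eq_Rintegral.
  have FF : Filter (nbhs (almost_everywhere mu)) by exact: ae_filter_ringOfSetsType.
  apply: (filterS3 FF) Eq E1 E2 => t -> -> ->.
  by rewrite weight_dot_section// (c0 t) (cp t).
have iqc := ib _ _ 0 mq bq; have i1c := ib _ _ 0 m1 b1.
have i2s := ib _ _ (pi / 2) m2 b2.
have jq := integrable_mulrl (1 + s ^+ 2) iq.
have jqc := integrable_mulrl (2 * s) iqc.
have j1 := integrable_mulrl (2 * s * c) i1.
have j1c := integrable_mulrl ((1 + s ^+ 2) * c) i1c.
have j2s := integrable_mulrl ((1 - s ^+ 2) * c) i2s.
have j11 := integrable_addr j1 j1c.
rewrite (RintegralD measurableT (integrable_addr jq jqc) (integrable_addr j11 j2s)).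
rewrite (RintegralD measurableT jq jqc) (RintegralD measurableT j11 j2s).
rewrite (RintegralD measurableT j1 j1c) !RintegralZl//.
rewrite !Iq !I1 !I2 Iq0 I10 Dx Dy.
set x := dot (partial_x F 0) q.
have -> : 2 * s * (x / 2) = s * x by field.
by [].
Qed.

End FunctionalI.

(** * Complex differentiability in real coordinates *)

Section Holomorphic.
Context (R : realType).

(** [f + i g] is complex differentiable at [z] with derivative [f' + i g']: both
    real differentials are spelled out through the Cauchy-Riemann equations. *)
Definition hol (f g f' g' : R * R -> R) (z : R * R) : Prop :=
  is_diff z f (fun u => f' z * u.1 - g' z * u.2) /\
  is_diff z g (fun u => g' z * u.1 + f' z * u.2).

Lemma is_diff_fst (z : R * R) : is_diff z (fst : R * R -> R) fst.
Proof.
have cf : continuous (fst : R * R -> R^o) by move=> x; exact: cvg_fst.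
split; first exact: (@linear_differentiable R (R * R)%type R^o fst z cf).
exact: (@diff_lin R (R * R)%type R^o fst z cf).
Qed.

Lemma is_diff_snd (z : R * R) : is_diff z (snd : R * R -> R) snd.
Proof.
have cf : continuous (snd : R * R -> R^o) by move=> x; exact: cvg_snd.
split; first exact: (@linear_differentiable R (R * R)%type R^o snd z cf).
exact: (@diff_lin R (R * R)%type R^o snd z cf).
Qed.

Lemma hol_mul f1 g1 f1' g1' f2 g2 f2' g2' z :
  hol f1 g1 f1' g1' z -> hol f2 g2 f2' g2' z ->
  hol (fun z => f1 z * f2 z - g1 z * g2 z) (fun z => f1 z * g2 z + g1 z * f2 z)
      (fun z => f1' z * f2 z - g1' z * g2 z + (f1 z * f2' z - g1 z * g2' z))
      (fun z => f1' z * g2 z + g1' z * f2 z + (f1 z * g2' z + g1 z * f2' z)) z.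
Proof.
move=> [F1 G1] [F2 G2]; split.
  apply: (is_diff_eq (is_diffB (is_diffM F1 F2) (is_diffM G1 G2))).
  by apply/funext => u; rewrite !fctE /GRing.scale /=; ring.
apply: (is_diff_eq (is_diffD (is_diffM F1 G2) (is_diffM G1 F2))).
by apply/funext => u; rewrite !fctE /GRing.scale /=; ring.
Qed.

Lemma is_diff_inv (f df : R * R -> R) z : f z != 0 -> is_diff z f df ->
  is_diff z (fun x => (f x)^-1) (fun u => - (f z)^-2 * df u).
Proof.
move=> fz [dfz <-]; split; first exact: differentiableV.
by rewrite diffV//; apply/funext => u; rewrite !fctE /GRing.scale /=.
Qed.

(** The derivative is written through the inverse [a + i b] itself, as
    [- (f' + i g') (a + i b)^2], so that its continuity follows from that of [a]
    and [b]. *)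
Lemma hol_inv (f g f' g' : R * R -> R) z : f z ^+ 2 + g z ^+ 2 != 0 ->
  hol f g f' g' z ->
  let a z := f z / (f z ^+ 2 + g z ^+ 2) in
  let b z := - g z / (f z ^+ 2 + g z ^+ 2) in
  hol a b (fun z => g' z * (2 * a z * b z) - f' z * (a z ^+ 2 - b z ^+ 2))
          (fun z => - g' z * (a z ^+ 2 - b z ^+ 2) - f' z * (2 * a z * b z)) z.
Proof.
move=> n0 [F G] a b.
have N := is_diff_inv n0 (is_diffD (is_diffM F F) (is_diffM G G)).
split.
  apply: (is_diff_eq (is_diffM F N)).
  by apply/funext => u; rewrite !fctE /GRing.scale /a /b /=; field.
apply: (is_diff_eq (is_diffM (is_diffN G) N)).
by apply/funext => u; rewrite !fctE /GRing.scale /a /b /=; field.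
Qed.

Lemma hol_affine (f g f' g' : R * R -> R) (a b k : R) (z : R * R) :
  hol f g f' g' (a + k * z.1, b + k * z.2) ->
  hol (fun z => f (a + k * z.1, b + k * z.2)) (fun z => g (a + k * z.1, b + k * z.2))
      (fun z => k * f' (a + k * z.1, b + k * z.2))
      (fun z => k * g' (a + k * z.1, b + k * z.2)) z.
Proof.
move=> [F G].
pose A (z : R * R) := (a + k * z.1, b + k * z.2).
have dA : is_diff z A (fun u => (k * u.1, k * u.2)).
  apply: (is_diff_eq (is_diff_pair (is_diffD (is_diff_cst a z) (is_diffZ k (is_diff_fst z)))
   (is_diffD (is_diff_cst b z) (is_diffZ k (is_diff_snd z))))).
  by apply/funext => u; rewrite !fctE /GRing.scale /= !add0r.
split.
  apply: (is_diff_eq (is_diff_comp (g := f) dA F)).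
  by apply/funext => u /=; ring.
apply: (is_diff_eq (is_diff_comp (g := g) dA G)).
by apply/funext => u /=; ring.
Qed.

Lemma is_derive_diff1 (V : normedModType R) (h : R -> V) (t : R) (d : V) :
  is_derive t 1 h d -> is_diff t h ( *:%R^~ d).
Proof.
move=> [dh <-]; have dh' : differentiable h t by exact/derivable1_diffP.
split => //; rewrite deriv1E//; apply/funext => u.
by rewrite derive1E.
Qed.

Lemma is_derive_curve (f : R * R -> R) df (c1 c2 : R -> R) (t d1 d2 : R) :
  is_diff (c1 t, c2 t) f df ->
  is_derive t 1 c1 d1 -> is_derive t 1 c2 d2 ->
  is_derive t 1 (fun t => f (c1 t, c2 t)) (df (d1, d2)).
Proof.
move=> F /is_derive_diff1 C1 /is_derive_diff1 C2.
have [D E] := is_diff_comp (f := fun t => (c1 t, c2 t)) (g := f) (is_diff_pair C1 C2) F.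
split; first exact: diff_derivable.
rewrite deriveE// E.
by rewrite /= !scale1r.
Qed.

End Holomorphic.

(** * Integrals over one turn depending on a parameter *)

Lemma continuous_mkpair (T : topologicalType) (R : realType) (f g : T -> R) (x : T) :
  {for x, continuous f} -> {for x, continuous g} ->
  {for x, continuous (fun x => (f x, g x))}.
Proof. by move=> cf cg; apply: (cvg_pair cf cg). Qed.

Section TurnIntegral.
Context (R : realType).

Definition turn : set R := `[0, 2 * pi]%classic.

Lemma measurable_turn : measurable (turn : set (measurableTypeR R)).
Proof. exact: measurable_itv. Qed.

Definition turn_integral (f : R -> R) : R :=
  \int[@lebesgue_measure R]_(t in turn) f t.

Lemma turn_integrable (f : R -> R) : continuous f ->
  (@lebesgue_measure R).-integrable turn (EFin \o f).
Proof.
move=> cf; apply: continuous_compact_integrable; first exact: segment_compact.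
by apply: continuous_subspaceT.
Qed.

Lemma continuous_pairr (k : R * R -> R) (x : R) : continuous k ->
  continuous (fun t => k (x, t)).
Proof.
move=> ck t; apply: (@continuous_comp _ _ _ (fun t => (x, t)) k); last exact: ck.
by apply: continuous_mkpair; [exact: cvg_cst|exact: cvg_id].
Qed.

Lemma turn_integral_derive (f df : R -> R) : continuous df ->
  (forall t : R, is_derive t 1 f (df t)) ->
  turn_integral df = f (2 * pi) - f 0.
Proof.
move=> cdf dF; rewrite /turn_integral /Rintegral.
have cf : continuous f.
  by move=> t; apply: differentiable_continuous; apply/derivable1_diffP; case: (dF t).
rewrite (continuous_FTC2 (F := f)) //.
- exact: two_pi_gt0.
- exact: continuous_subspaceT.
- split=> [t _||]; first by case: (dF t).
  + by apply: cvg_at_right_filter; exact: cf.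
  + by apply: cvg_at_left_filter; exact: cf.
- by move=> t _; rewrite derive1E; case: (dF t).
Qed.

(** Differentiation under the integral sign; the domination comes from the joint
    continuity of [dk] on a compact rectangle. *)
Lemma turn_integral_cst_param (k dk : R -> R -> R) :
  (forall x t : R, is_derive x 1 (k^~ t) (dk x t)) ->
  (forall x, continuous (k x)) ->
  continuous (fun p : R * R => dk p.1 p.2) ->
  (forall x, turn_integral (dk x) = 0) ->
  forall x y, turn_integral (k x) = turn_integral (k y).
Proof.
move=> kd ck cdk dk0 x0 y0.
apply: (@is_derive_0_is_cst _ (fun x => turn_integral (k x))) => x.
have [M MP] : exists M : R, forall y t, `]x - 1, x + 1[%classic y -> turn t -> `|dk y t| <= M.
  have cpt : compact (`[x - 1, x + 1]%classic `*` turn).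
    by apply: compact_setX; exact: segment_compact.
  have cptK := continuous_compact (continuous_subspaceT cdk) cpt.
  have [M [_ MP]] := compact_bounded cptK.
  exists (M + 1) => y t xy tt; apply: (MP (M + 1)); first by rewrite ltrDl.
  exists (y, t) => //; split => //=.
  exact: subset_itv_oo_cc.
have Ix : `]x - 1, x + 1[%classic x.
  by rewrite /= in_itv /= ltrBlDr ltrDl ltr01.
have mt : measurable (turn : set (measurableTypeR R)) by exact: measurable_itv.
have iM : (@lebesgue_measure R).-integrable turn (EFin \o cst `|M|).
  by apply: turn_integrable => t; exact: cvg_cst.
have E y t : partial1of2 k y t = dk y t.
  by rewrite /partial1of2 derive1E; case: (kd y t).
have ub (y t : R) : `]x - 1, x + 1[%classic y -> turn t -> `|partial1of2 k y t| <= cst `|M| t.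
  by move=> xy tt; rewrite E /= (le_trans (MP _ _ xy tt))// ler_norm.
have di y t : `]x - 1, x + 1[%classic y -> turn t -> derivable (k^~ t) y 1.
  by move=> _ _; case: (kd y t).
have ik y : `]x - 1, x + 1[%classic y -> (@lebesgue_measure R).-integrable turn (EFin \o k y).
  by move=> _; exact: turn_integrable.
have M0 (y : R) : 0 <= cst `|M| y by [].
split; first exact: (derivable_under_integral mt Ix ik di M0 iM ub).
rewrite -derive1E (differentiation_under_integral mt Ix ik di M0 iM ub).
rewrite -[RHS](dk0 x); apply: eq_Rintegral => t _; exact: E.
Qed.

Lemma turn_integral_addr (f g : R -> R) : continuous f -> continuous g ->
  turn_integral (fun t => f t + g t) = turn_integral f + turn_integral g.
Proof.
by move=> cf cg; apply: RintegralD; [exact: measurable_turn|exact: turn_integrable..].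
Qed.

Lemma turn_integral_mulrl (c : R) (f : R -> R) : continuous f ->
  turn_integral (fun t => c * f t) = c * turn_integral f.
Proof.
by move=> cf; apply: RintegralZl; [exact: measurable_turn|exact: turn_integrable].
Qed.

Lemma turn_integral_cst (c : R) : turn_integral (cst c) = c * (2 * pi).
Proof.
rewrite /turn_integral Rintegral_cst; last exact: measurable_turn.
have : (@lebesgue_measure R) `[0, 2 * pi]%classic = (2 * pi)%:E.
  by rewrite lebesgue_measure_itv /= lte_fin two_pi_gt0 oppr0 adde0.
by move=> /(congr1 fine) /= <-.
Qed.

Lemma eq_turn_integral (f g : R -> R) : f =1 g -> turn_integral f = turn_integral g.
Proof. by move=> fg; apply: eq_Rintegral => t _; exact: fg. Qed.

End TurnIntegral.

(** * Cauchy theorem on the unit circle *)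

Section Cauchy.
Context (R : realType).

Lemma cvg_comp_pair (T : Type) (F : set_system T) {FF : Filter F}
    (V : topologicalType) (c1 c2 : T -> R) (h : R * R -> V) (a b : R) :
  {for (a, b), continuous h} -> c1 @ F --> a -> c2 @ F --> b ->
  h (c1 t, c2 t) @[t --> F] --> h (a, b).
Proof.
move=> ch c1a c2b.
by apply: (@continuous_cvg _ _ _ _ _ (fun t => (c1 t, c2 t)) h) => //; exact: (cvg_pair c1a c2b).
Qed.

Lemma cvg_comp_cos (T : Type) (F : set_system T) {FF : Filter F} (c : T -> R) (a : R) :
  c @ F --> a -> cos (c t) @[t --> F] --> cos a.
Proof. by move=> ca; apply: continuous_cvg => //; exact: continuous_cos. Qed.

Lemma cvg_comp_sin (T : Type) (F : set_system T) {FF : Filter F} (c : T -> R) (a : R) :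
  c @ F --> a -> sin (c t) @[t --> F] --> sin a.
Proof. by move=> ca; apply: continuous_cvg => //; exact: continuous_sin. Qed.

Lemma hol_continuous (f g f' g' : R * R -> R) z : hol f g f' g' z ->
  {for z, continuous f} /\ {for z, continuous g}.
Proof. by move=> [[df _] [dg _]]; split; exact: differentiable_continuous. Qed.

(** The real part of [k(z) z], with [k = f + i g], has integral zero over the
    circle.  The integral of [k(w) w] over the circle of radius [sin x] does not
    depend on [x]: its derivative in [x] is at the same time the [t]-derivative
    of the [2 pi]-periodic function [l] below.  It vanishes for [x = 0]. *)
Lemma turn_integral_hol_eq0 (f g f' g' : R * R -> R) :
  (forall z, z.1 ^+ 2 + z.2 ^+ 2 <= 1 ->
    [/\ hol f g f' g' z, {for z, continuous f'} & {for z, continuous g'}]) ->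
  turn_integral (fun t =>
    f (cos t, sin t) * cos t - g (cos t, sin t) * sin t) = 0.
Proof.
move=> hf.
have in1 (x t : R) : (sin x * cos t) ^+ 2 + (sin x * sin t) ^+ 2 <= 1.
  rewrite !exprMn -mulrDr cos2Dsin2 mulr1.
  by have := cos2Dsin2 x; have := sqr_ge0 (cos x); lra.
have hF x t := hf (sin x * cos t, sin x * sin t) (in1 x t).
(* Taking [sin x] as the radius keeps the point in the closed disk for all real x. *)
pose w x t : R * R := (sin x * cos t, sin x * sin t).
pose k x t := sin x * (f (w x t) * cos t - g (w x t) * sin t).
pose e x t := f (w x t) * cos t - g (w x t) * sin t +
  sin x * (f' (w x t) * (cos t ^+ 2 - sin t ^+ 2) - 2 * g' (w x t) * cos t * sin t).
pose dk x t := cos x * e x t.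
(* [l] is [cos x] times the imaginary part of [k(w) e^(it)]. *)
pose l x t := cos x * (f (w x t) * sin t + g (w x t) * cos t).
have kd (x t : R) : is_derive x 1 (k^~ t) (dk x t).
  have [[F G] _ _] := hF x t.
  have w1 : is_derive x 1 (fun x => sin x * cos t) (cos x * cos t).
    apply: (is_derive_eq (is_deriveM (is_derive_sin x) (is_derive_cst (cos t) x 1))).
    by rewrite /GRing.scale /=; ring.
  have w2 : is_derive x 1 (fun x => sin x * sin t) (cos x * sin t).
    apply: (is_derive_eq (is_deriveM (is_derive_sin x) (is_derive_cst (sin t) x 1))).
    by rewrite /GRing.scale /=; ring.
  have dF := @is_derive_curve _ _ _ (fun x => sin x * cos t) (fun x => sin x * sin t) _ _ _ F w1 w2.
  have dG := @is_derive_curve _ _ _ (fun x => sin x * cos t) (fun x => sin x * sin t) _ _ _ G w1 w2.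
  have dFc := is_deriveM dF (is_derive_cst (cos t) x 1).
  have dGs := is_deriveM dG (is_derive_cst (sin t) x 1).
  apply: (is_derive_eq (is_deriveM (is_derive_sin x) (is_deriveB dFc dGs))).
  by rewrite /dk /e /w /GRing.scale /= !fctE; ring.
have ld (x t : R) : is_derive t 1 (l x) (dk x t).
  have [[F G] _ _] := hF x t.
  have w1 : is_derive t 1 (fun t => sin x * cos t) (- (sin x * sin t)).
    apply: (is_derive_eq (is_deriveM (is_derive_cst (sin x) t 1) (is_derive_cos t))).
    by rewrite /GRing.scale /=; ring.
  have w2 : is_derive t 1 (fun t => sin x * sin t) (sin x * cos t).
    apply: (is_derive_eq (is_deriveM (is_derive_cst (sin x) t 1) (is_derive_sin t))).
    by rewrite /GRing.scale /=; ring.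
  have dF := @is_derive_curve _ _ _ (fun t => sin x * cos t) (fun t => sin x * sin t) _ _ _ F w1 w2.
  have dG := @is_derive_curve _ _ _ (fun t => sin x * cos t) (fun t => sin x * sin t) _ _ _ G w1 w2.
  have dFs := is_deriveM dF (is_derive_sin t).
  have dGc := is_deriveM dG (is_derive_cos t).
  apply: (is_derive_eq (is_deriveM (is_derive_cst (cos x) t 1) (is_deriveD dFs dGc))).
  by rewrite /dk /e /w /GRing.scale /= !fctE; ring.
have cw1 (p : R * R) : sin x.1 * cos x.2 @[x --> p] --> sin p.1 * cos p.2.
  by apply: cvgM; [apply: cvg_comp_sin; exact: cvg_fst|apply: cvg_comp_cos; exact: cvg_snd].
have cw2 (p : R * R) : sin x.1 * sin x.2 @[x --> p] --> sin p.1 * sin p.2.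
  by apply: cvgM; [apply: cvg_comp_sin; exact: cvg_fst|apply: cvg_comp_sin; exact: cvg_snd].
have cc (h : R * R -> R) : (forall z, z.1 ^+ 2 + z.2 ^+ 2 <= 1 -> {for z, continuous h}) ->
    continuous (fun p : R * R => h (w p.1 p.2)).
  by move=> ch p; apply: cvg_comp_pair; [apply: ch; exact: in1|exact: cw1|exact: cw2].
have cf := cc f (fun z z1 => (hol_continuous (let: And3 h _ _ := hf z z1 in h)).1).
have cg := cc g (fun z z1 => (hol_continuous (let: And3 h _ _ := hf z z1 in h)).2).
have cf' := cc f' (fun z z1 => let: And3 _ h _ := hf z z1 in h).
have cg' := cc g' (fun z z1 => let: And3 _ _ h := hf z z1 in h).
have cdk : continuous (fun p : R * R => dk p.1 p.2).
  have c1 : continuous (fun p : R * R => cos p.1).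
    by move=> p; apply: cvg_comp_cos; exact: cvg_fst.
  have s1 : continuous (fun p : R * R => sin p.1).
    by move=> p; apply: cvg_comp_sin; exact: cvg_fst.
  have c2 : continuous (fun p : R * R => cos p.2).
    by move=> p; apply: cvg_comp_cos; exact: cvg_snd.
  have s2 : continuous (fun p : R * R => sin p.2).
    by move=> p; apply: cvg_comp_sin; exact: cvg_snd.
  move=> p; rewrite /dk /e.
  apply: cvgM; first exact: c1.
  apply: cvgD; first by apply: cvgB; apply: cvgM; [exact: cf|exact: c2|exact: cg|exact: s2].
  apply: cvgM; first exact: s1.
  apply: cvgB.
    apply: cvgM; first exact: cf'.
    by apply: cvgB; apply: cvgM; [exact: c2|exact: c2|exact: s2|exact: s2].
  do 3 (apply: cvgM; last by [exact: s2|exact: c2|exact: cg']).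
  exact: cvg_cst.
have ck x : continuous (k x).
  move=> t; apply: cvgM; first exact: cvg_cst.
  by apply: cvgB; apply: cvgM; [exact: (continuous_pairr (k := fun p => f (w p.1 p.2)))|exact: continuous_cos|
   exact: (continuous_pairr (k := fun p => g (w p.1 p.2)))|exact: continuous_sin].
have dk0 x : turn_integral (dk x) = 0.
  rewrite (turn_integral_derive (f := l x)) //.
    by rewrite /l /w mulr_natl cos2pi sin2pi cos0 sin0 subrr.
  exact: (continuous_pairr (k := fun p => dk p.1 p.2)).
have := turn_integral_cst_param kd ck cdk dk0 (pi / 2) 0.
have -> : turn_integral (k 0) = 0.
  rewrite /turn_integral (@eq_Rintegral _ _ _ _ _ (cst 0)).
    by rewrite Rintegral_cst ?mul0r//; exact: measurable_itv.
  by move=> t _; rewrite /k sin0 mul0r.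
move=> <-; apply: eq_Rintegral => t _.
by rewrite /k /w sin_pihalf !mul1r.
Qed.

End Cauchy.

(** * Symmetry of second derivatives *)

Section MixedDerivatives.
Context (R : realType) (V : normedModType R).
Implicit Types (u p : V -> R) (z w a b : V).

(** The definition of differentiability with an explicit radius. *)
Lemma differentiable_bound p z (e : R) : differentiable p z -> 0 < e ->
  exists2 d : R, 0 < d &
    forall v, `|v| < d -> `|p (v + z) - p z - 'd p z v| <= e * `|v|.
Proof.
move=> dp e0; have /eqaddoP/(_ e e0) := diff_locally dp.
move=> /nbhs_normP[d /= d0 dP]; exists d => // v vd.
have /= := dP v; rewrite /ball_ /= sub0r normrN => /(_ vd).
by rewrite !fctE /= opprD addrA.
Qed.

Lemma is_derive_line u w a (x : R) : differentiable u (x *: a + w) ->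
  is_derive x 1 (fun x => u (x *: a + w)) ('D_a u (x *: a + w)).
Proof.
move=> du.
have L : is_diff x (fun x : R => x *: a + w) ( *:%R^~ a).
  apply: (is_diff_eq (is_diffD (is_diff_scalel x a) (is_diff_cst w x))).
  by apply/funext => k; rewrite !fctE addr0.
have [D E] := is_diff_comp (f := fun x : R => x *: a + w) (g := u) L (differentiableP du).
split; first exact: diff_derivable.
by rewrite deriveE// E /= scale1r deriveE.
Qed.

Lemma diffZv p z (k : R) v : 'd p z (k *: v) = k * 'd p z v.
Proof. exact: linearZ. Qed.

Lemma diffDv p z v w : 'd p z (v + w) = 'd p z v + 'd p z w.
Proof. exact: linearD. Qed.

Lemma ler_scaled (x y h e : R) : 0 < h -> `|x - h * y| <= e * h ->
  `|x * h - h ^+ 2 * y| <= e * h ^+ 2.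
Proof.
move=> h0 xy; have -> : x * h - h ^+ 2 * y = h * (x - h * y) by ring.
have -> : e * h ^+ 2 = h * (e * h) by ring.
by rewrite normrM gtr0_norm// ler_pM2l.
Qed.

Definition mixed_difference u z a b (h : R) : R :=
  u (h *: a + (h *: b + z)) - u (h *: a + z) - (u (h *: b + z) - u z).

Lemma mixed_differenceC u z a b h :
  mixed_difference u z a b h = mixed_difference u z b a h.
Proof.
by rewrite /mixed_difference (addrCA (h *: a)); ring.
Qed.

(** The mean value theorem along [a] reduces the mixed difference to an increment
    of ['D_a u] in the direction [b]; differentiability of ['D_a u] at the single
    point [z] is enough to estimate it. *)
Lemma mixed_difference_bound u z a b (e : R) :
  (\forall w \near z, differentiable u w) -> differentiable ('D_a u) z ->
  0 < e -> exists2 d : R, 0 < d & forall h : R, 0 < h < d ->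
    `|mixed_difference u z a b h - h ^+ 2 * 'D_b ('D_a u) z| <= e * h ^+ 2.
Proof.
move=> /nbhs_normP[d1 /= d10 du] dp e0.
pose c := `|a| + `|b| + 1.
have c0 : 0 < c by rewrite ltr_wpDl// addr_ge0.
have e'0 : 0 < e / (2 * c) by rewrite divr_gt0// mulr_gt0.
have [d2 d20 dP] := differentiable_bound dp e'0.
pose d := Num.min d1 d2.
have d0 : 0 < d by rewrite lt_min d10.
exists (d / c); first by rewrite divr_gt0.
move=> h /andP[h0]; rewrite ltr_pdivlMr// => hc.
have small x v : 0 <= x <= h -> v = 0 \/ v = h *: b -> `|x *: a + v| <= h * c.
  move=> /andP[x0 xh] vE; rewrite (le_trans (ler_normD _ _))// normrZ ger0_norm//.
  have va : `|v| <= h * `|b|.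
    by case: vE => ->; rewrite ?normr0 ?mulr_ge0 ?(ltW h0)// normrZ gtr0_norm.
  rewrite /c; have := normr_ge0 a; have := normr_ge0 b; nra.
have hcd1 : h * c < d1 by apply: lt_le_trans hc _; rewrite ge_min lexx.
have hcd2 : h * c < d2 by apply: lt_le_trans hc _; rewrite ge_min lexx orbT.
have du' x v : 0 <= x <= h -> v = 0 \/ v = h *: b -> differentiable u (x *: a + (v + z)).
  move=> xh vE; apply: du; rewrite /ball_ /= addrA opprD addrCA subrr addr0 normrN.
  exact: le_lt_trans (small _ _ xh vE) hcd1.
pose f x := u (x *: a + (h *: b + z)) - u (x *: a + z).
pose df x := 'D_a u (x *: a + (h *: b + z)) - 'D_a u (x *: a + z).
have fd x : 0 <= x <= h -> is_derive x 1 f (df x).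
  move=> xh.
  have h1 := is_derive_line (du' x _ xh (or_intror erefl)).
  have h2 := is_derive_line (du' x _ xh (or_introl erefl)).
  by rewrite add0r in h2; exact: is_deriveB.
have [x xh fE] : exists2 x, 0 <= x <= h & f h - f 0 = df x * h.
  have fd' x : x \in `]0, h[ -> is_derive x 1 f (df x).
    by rewrite in_itv/= => /andP[x0 xh]; apply: fd; rewrite !ltW.
  have cf : {within `[0, h], continuous f}.
    apply: derivable_within_continuous => x; rewrite in_itv/= => xh.
    by case: (fd x xh).
  have [x + E] := MVT h0 fd' cf; rewrite in_itv/= => /andP[x0 xh].
  by exists x; rewrite ?(ltW x0) ?(ltW xh)// E subr0.
have -> : mixed_difference u z a b h = df x * h.
  by rewrite -fE /mixed_difference /f !scale0r !add0r.
have P1 := dP (x *: a + h *: b) (le_lt_trans (small _ _ xh (or_intror erefl)) hcd2).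
have P2 := dP (x *: a + 0) (le_lt_trans (small _ _ xh (or_introl erefl)) hcd2).
have S1 := small _ _ xh (or_intror erefl).
have S2 := small _ _ xh (or_introl erefl).
rewrite addr0 in P2 S2; rewrite -(addrA (x *: a)) diffDv in P1.
have dE : 'd ('D_a u) z (h *: b) = h * 'D_b ('D_a u) z by rewrite diffZv deriveE.
have : `|df x - h * 'D_b ('D_a u) z| <= e * h.
  rewrite -dE; apply: (@le_trans _ _ (e / (2 * c) * (h * c) + e / (2 * c) * (h * c))).
    have -> : df x - 'd ('D_a u) z (h *: b) =
       ('D_a u (x *: a + (h *: b + z)) - 'D_a u z - ('d ('D_a u) z (x *: a) + 'd ('D_a u) z (h *: b)))
       - ('D_a u (x *: a + z) - 'D_a u z - 'd ('D_a u) z (x *: a)) by rewrite /df; ring.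
    apply: (le_trans (ler_normB _ _)); apply: lerD.
      by apply: (le_trans P1); rewrite ler_wpM2l// ltW.
    by apply: (le_trans P2); rewrite ler_wpM2l// ltW.
  by rewrite le_eqVlt; apply/orP; left; apply/eqP; field; rewrite gt_eqF.
exact: ler_scaled.
Qed.

Lemma quadratic_coefficient_unique (m : R -> R) (X Y : R) :
  (forall e : R, 0 < e -> exists2 d : R, 0 < d &
    forall h : R, 0 < h < d -> `|m h - h ^+ 2 * X| <= e * h ^+ 2) ->
  (forall e : R, 0 < e -> exists2 d : R, 0 < d &
    forall h : R, 0 < h < d -> `|m h - h ^+ 2 * Y| <= e * h ^+ 2) ->
  X = Y.
Proof.
move=> mX mY; apply/eqP; rewrite -subr_eq0 -normr_eq0; apply/negP => /negP h.
pose D : R := `|X - Y|.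
have D0 : 0 < D / 4 by rewrite divr_gt0// lt0r h normr_ge0.
have [d1 d10 P1] := mX _ D0; have [d2 d20 P2] := mY _ D0.
pose x : R := Num.min d1 d2 / 2.
have d0 : 0 < Num.min d1 d2 by rewrite lt_min d10.
have x0 : 0 < x by rewrite divr_gt0.
have xd : x < Num.min d1 d2 by rewrite /x ltr_pdivrMr// ltr_pMr// ltr1n.
have xd1 : x < d1 by apply: lt_le_trans xd _; rewrite ge_min lexx.
have xd2 : x < d2 by apply: lt_le_trans xd _; rewrite ge_min lexx orbT.
have := P1 x; rewrite x0 xd1 => /(_ isT) Q1.
have := P2 x; rewrite x0 xd2 => /(_ isT) Q2.
have x2 : 0 < x ^+ 2 by rewrite exprn_gt0.
have : x ^+ 2 * D <= (D / 4 + D / 4) * x ^+ 2.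
  rewrite [x ^+ 2 * D](_ : _ = `|x ^+ 2 * (X - Y)|); last by rewrite normrM gtr0_norm.
  have -> : x ^+ 2 * (X - Y) = (m x - x ^+ 2 * Y) - (m x - x ^+ 2 * X) by ring.
  by apply: (le_trans (ler_normB _ _)); rewrite mulrDl; exact: lerD.
by rewrite mulrC ler_pM2r//; lra.
Qed.

(** The mixed difference is symmetric in the two directions, and its leading
    coefficient is either of the two iterated derivatives. *)
Lemma derive_derive_sym u z a b :
  (\forall w \near z, differentiable u w) ->
  differentiable ('D_a u) z -> differentiable ('D_b u) z ->
  'D_b ('D_a u) z = 'D_a ('D_b u) z.
Proof.
move=> du da db.
apply: (@quadratic_coefficient_unique (mixed_difference u z a b)) => e e0.
  exact: mixed_difference_bound.
have [d d0 dP] := mixed_difference_bound a du db e0.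
by exists d => // h hd; rewrite mixed_differenceC; exact: dP.
Qed.

End MixedDerivatives.

(** * The Poisson formula for scalar harmonic functions *)

Section Poisson.
Context (R : realType).

Lemma unit_disk_nbhs (z : R * R) : unit_disk z -> \forall w \near z, unit_disk w.
Proof.
move=> z1.
have c2 : continuous (fun z : R * R => z.1 ^+ 2 + z.2 ^+ 2).
  by move=> w; apply: (cvgD (cvgM cvg_fst cvg_fst) (cvgM cvg_snd cvg_snd)).
exact: (cvgr_lt _ (c2 z) _ z1).
Qed.

Lemma unit_disk0 : unit_disk (0 : R * R).
Proof. by rewrite /unit_disk /= expr0n addr0 ltr01. Qed.

Lemma diff_coordE (V : normedModType R) (f : R * R -> V) (z u : R * R) : differentiable f z ->
  'd f z u = u.1 *: 'D_((1, 0) : R * R) f z + u.2 *: 'D_((0, 1) : R * R) f z.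
Proof.
move=> df; rewrite !deriveE// -!linearZ -linearD; congr ('d f z _).
by case: u => a b; congr (_, _) => /=; rewrite /GRing.scale /= ?mulr1 ?mulr0 ?addr0 ?add0r.
Qed.

Lemma diff_coordRE (f : R * R -> R) (z u : R * R) : differentiable f z ->
  'd f z u = u.1 * 'D_((1, 0) : R * R) f z + u.2 * 'D_((0, 1) : R * R) f z.
Proof. exact: diff_coordE. Qed.

(** Here [p] and [q] stand for the partial derivatives of a harmonic function:
    the Cauchy-Riemann equations for [p - i q] are the symmetry of the second
    derivatives and the Laplace equation. *)
Lemma hol_of_partials (p q : R * R -> R) (z : R * R) :
  differentiable p z -> differentiable q z ->
  'D_((0, 1) : R * R) p z = 'D_((1, 0) : R * R) q z ->
  'D_((1, 0) : R * R) p z + 'D_((0, 1) : R * R) q z = 0 ->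
  hol p (fun z => - q z)
      ('D_((1, 0) : R * R) p) (fun z => - 'D_((1, 0) : R * R) q z) z.
Proof.
move=> dp dq sym lap; split.
  split=> //; apply/funext => v; rewrite (diff_coordRE v dp) sym.
  by move: ('D_(1, 0) p z) ('D_(1, 0) q z) => a b; ring.
apply: (is_diff_eq (is_diffN (differentiableP dq))).
apply/funext => v; rewrite fctE (diff_coordRE v dq).
have -> : 'D_((0, 1) : R * R) q z = - 'D_((1, 0) : R * R) p z.
  by apply/eqP; rewrite -addr_eq0 addrC lap.
by move: ('D_(1, 0) p z) ('D_(1, 0) q z) => a b; ring.
Qed.

Lemma harmonic_gradient_hol (u : R * R -> R) (z : R * R) :
  harmonic_on_disk u -> unit_disk z ->
  hol (partial_x u) (fun z => - partial_y u z)
      (partial_x (partial_x u)) (fun z => - partial_x (partial_y u) z) z.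
Proof.
move=> [hC2 hL] z1; have [du ddu _] := hC2 z z1.
have du' : \forall w \near z, differentiable u w.
  by apply: filterS (unit_disk_nbhs z1) => w /hC2[].
have dp := ddu (1, 0); have dq := ddu (0, 1).
exact: (hol_of_partials dp dq (derive_derive_sym du' dp dq) (hL z z1)).
Qed.

Lemma hol_cst (a b : R) (z : R * R) : hol (cst a) (cst b) (cst 0) (cst 0) z.
Proof.
split; apply: (is_diff_eq (is_diff_cst _ z)); apply/funext => u; transitivity (0 : R) => //; rewrite /cst; ring.
Qed.

Section Kernel.
Variables (r theta : R).
Hypothesis r01 : 0 <= r < 1.
(* The point at which the kernel is centred is [z0 = x0 + i y0], and [D + i E] is [1 - conj(z0) z]. *)
Let x0 := r * cos theta.
Let y0 := r * sin theta.

Let D (z : R * R) : R := 1 - (x0 * z.1 + y0 * z.2).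
Let E (z : R * R) : R := y0 * z.1 - x0 * z.2.

Let z02 : x0 ^+ 2 + y0 ^+ 2 = r ^+ 2.
Proof. by rewrite /x0 /y0 !exprMn -mulrDr cos2Dsin2 mulr1. Qed.

Let DE_hol z : hol D E (cst (- x0)) (cst y0) z.
Proof.
have f1 := is_diff_fst z; have f2 := is_diff_snd z.
split.
  apply: (is_diff_eq (is_diffB (is_diff_cst (1 : R) z) (is_diffD (is_diffZ x0 f1) (is_diffZ y0 f2)))).
  apply/funext => u; rewrite !fctE /GRing.scale /=.
  by transitivity (0 - (x0 * u.1 + y0 * u.2)) => //; ring.
apply: (is_diff_eq (is_diffB (is_diffZ y0 f1) (is_diffZ x0 f2))).
by apply/funext => u; rewrite !fctE /GRing.scale /=; ring.
Qed.

Let N_gt0 (z : R * R) : z.1 ^+ 2 + z.2 ^+ 2 <= 1 -> 0 < D z ^+ 2 + E z ^+ 2.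
Proof.
move=> z1; rewrite ltr_pwDl ?sqr_ge0// exprn_gt0// /D.
have := sqr_ge0 (x0 - z.1); have := sqr_ge0 (y0 - z.2).
by have := z02; case/andP: r01 => r0 r1; nra.
Qed.

Let NE (t : R) : D (cos t, sin t) ^+ 2 + E (cos t, sin t) ^+ 2 =
  1 - 2 * r * cos (theta - t) + r ^+ 2.
Proof.
rewrite /D /E /= cosB -z02.
transitivity (1 - 2 * (x0 * cos t + y0 * sin t) + (x0 ^+ 2 + y0 ^+ 2) * (cos t ^+ 2 + sin t ^+ 2)).
  by ring.
by rewrite cos2Dsin2 mulr1 /x0 /y0; ring.
Qed.

Let kre (z : R * R) : R := D z / (D z ^+ 2 + E z ^+ 2).
Let kim (z : R * R) : R := - E z / (D z ^+ 2 + E z ^+ 2).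

Let kre' (z : R * R) : R := y0 * (2 * kre z * kim z) - (- x0) * (kre z ^+ 2 - kim z ^+ 2).
Let kim' (z : R * R) : R := (- y0) * (kre z ^+ 2 - kim z ^+ 2) - (- x0) * (2 * kre z * kim z).

Let kernel_hol (z : R * R) : z.1 ^+ 2 + z.2 ^+ 2 <= 1 ->
  [/\ hol kre kim kre' kim' z, {for z, continuous kre'} & {for z, continuous kim'}].
Proof.
move=> z1; have kh : hol kre kim kre' kim' z.
  by apply: hol_inv (DE_hol z); rewrite gt_eqF// N_gt0.
have [ckr cki] := hol_continuous kh.
have cr2 : {for z, continuous (fun z => kre z ^+ 2 - kim z ^+ 2)}.
  exact: (cvgB (cvgM ckr ckr) (cvgM cki cki)).
have cri : {for z, continuous (fun z => 2 * kre z * kim z)}.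
  by apply: cvgM cki; apply: cvgM ckr; exact: cvg_cst.
split=> //.
  by apply: cvgB; apply: cvgM; [exact: cvg_cst|exact: cri|exact: cvg_cst|exact: cr2].
by apply: cvgB; apply: cvgM; [exact: cvg_cst|exact: cr2|exact: cvg_cst|exact: cri].
Qed.

(** On the circle the Poisson kernel is a constant multiple of [1 / |z - z0|^2],
    and [(z - z0) / |z - z0|^2 = z / (1 - conj(z0) z)].  The integrand is
    therefore the real part of [z] times a holomorphic function, and Cauchy's
    theorem applies. *)
Lemma turn_integral_kernel_mul (f g f' g' : R * R -> R) :
  (forall z, z.1 ^+ 2 + z.2 ^+ 2 <= 1 ->
    [/\ hol f g f' g' z, {for z, continuous f'} & {for z, continuous g'}]) ->
  turn_integral (fun t =>
    (f (cos t, sin t) * (cos t - x0) - g (cos t, sin t) * (sin t - y0)) /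
    (1 - 2 * r * cos (theta - t) + r ^+ 2)) = 0.
Proof.
move=> fh.
have hk (z : R * R) : z.1 ^+ 2 + z.2 ^+ 2 <= 1 ->
    [/\ hol (fun z => f z * kre z - g z * kim z) (fun z => f z * kim z + g z * kre z)
      (fun z => f' z * kre z - g' z * kim z + (f z * kre' z - g z * kim' z))
      (fun z => f' z * kim z + g' z * kre z + (f z * kim' z + g z * kre' z)) z,
     {for z, continuous (fun z => f' z * kre z - g' z * kim z + (f z * kre' z - g z * kim' z))} &
     {for z, continuous (fun z => f' z * kim z + g' z * kre z + (f z * kim' z + g z * kre' z))}].
  move=> z1; have [h1 cf' cg'] := fh z z1; have [k1 ck' cl'] := kernel_hol z1.
  have [cf cg] := hol_continuous h1; have [ck cl] := hol_continuous k1.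
  split; first exact: hol_mul.
    exact: (cvgD (cvgB (cvgM cf' ck) (cvgM cg' cl)) (cvgB (cvgM cf ck') (cvgM cg cl'))).
  exact: (cvgD (cvgD (cvgM cf' cl) (cvgM cg' ck)) (cvgD (cvgM cf cl') (cvgM cg ck'))).
rewrite -[RHS](turn_integral_hol_eq0 hk); apply: eq_Rintegral => t _.
have N0 : D (cos t, sin t) ^+ 2 + E (cos t, sin t) ^+ 2 != 0.
  by rewrite gt_eqF//; apply: N_gt0; rewrite /= cos2Dsin2.
rewrite -NE /kre /kim.
have DC : D (cos t, sin t) * cos t + E (cos t, sin t) * sin t = cos t - x0.
  transitivity (cos t - x0 * (cos t ^+ 2 + sin t ^+ 2)); last by rewrite cos2Dsin2 mulr1.
  by rewrite /D /E /=; ring.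
have DS : D (cos t, sin t) * sin t - E (cos t, sin t) * cos t = sin t - y0.
  transitivity (sin t - y0 * (cos t ^+ 2 + sin t ^+ 2)); last by rewrite cos2Dsin2 mulr1.
  by rewrite /D /E /=; ring.
rewrite -DC -DS; move: (cos t) (sin t) (g _) (f _) (E _) (D _) N0 => C S G F e d N0.
by field.
Qed.

(** The kernel minus one is the integrand of [turn_integral_kernel_mul] for the
    constant function [2 conj(z0)]. *)
Lemma turn_integral_poisson_kernel :
  turn_integral (fun t => poisson_kernel r (theta - t)) = 2 * pi.
Proof.
have hc (z : R * R) : z.1 ^+ 2 + z.2 ^+ 2 <= 1 ->
    [/\ hol (cst x0) (cst (- y0)) (cst 0) (cst 0) z,
      {for z, continuous (cst 0 : R * R -> R)} & {for z, continuous (cst 0 : R * R -> R)}].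
  by move=> _; split; [exact: hol_cst|exact: cvg_cst|exact: cvg_cst].
have I0 := turn_integral_kernel_mul hc.
pose w t := (x0 * (cos t - x0) + y0 * (sin t - y0)) /
  (1 - 2 * r * cos (theta - t) + r ^+ 2).
have PE t : poisson_kernel r (theta - t) = 1 + 2 * w t.
  have : 1 - 2 * r * cos (theta - t) + r ^+ 2 != 0.
    by rewrite gt_eqF// poisson_denominator_gt0.
  rewrite /poisson_kernel /w.
  have -> : x0 * (cos t - x0) + y0 * (sin t - y0) = r * cos (theta - t) - r ^+ 2.
    rewrite cosB -z02 /x0 /y0.
    by move: (cos theta) (sin theta) (cos t) (sin t) => a b c d; ring.
  by move: (cos (theta - t)) => C N0; field.
have cw : continuous w.
  have -> : w = fun t => 2^-1 * (poisson_kernel r (theta - t) - 1).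
    by apply/funext => t; rewrite PE; field.
  move=> t; apply: cvgM; first exact: cvg_cst.
  apply: cvgB; last exact: cvg_cst.
  by apply: continuous_subl; exact: continuous_poisson_kernel.
have c1 : continuous (cst 1 : R -> R) by move=> t; exact: cvg_cst.
have c2w : continuous (fun t => 2 * w t).
  by move=> t; apply: cvgM; [exact: cvg_cst|exact: cw].
rewrite (eq_turn_integral PE) (turn_integral_addr c1 c2w) turn_integral_cst mul1r.
rewrite turn_integral_mulrl// [turn_integral w](_ : _ = 0) ?mulr0 ?addr0//.
by rewrite -[RHS]I0; apply: eq_turn_integral => t; rewrite /w /cst /= mulNr opprK.
Qed.

(** The integral of the kernel times [u] is constant along the homotopy [psi],
    which contracts the circle of radius [rho] to the point [rho z0]: the
    derivative of [u] along the homotopy is the real part of the holomorphic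
    gradient times [z - z0]. *)
Lemma poisson_formula (u : R * R -> R) (rho : R) : 0 <= rho < 1 ->
  harmonic_on_disk u ->
  turn_integral (fun t => poisson_kernel r (theta - t) * u (polar rho t)) =
    2 * pi * u (polar (rho * r) theta).
Proof.
move=> rho01 hu.
have hu1 z : unit_disk z -> differentiable u z by case/hu.1.
have hu2 z : unit_disk z -> forall v, differentiable ('D_v u) z by case/hu.1.
(* The homotopy parameter is [sin x ^+ 2], which stays in [0, 1] for all real x. *)
pose A (x : R) (z : R * R) : R * R :=
  (rho * cos x ^+ 2 * x0 + rho * sin x ^+ 2 * z.1,
   rho * cos x ^+ 2 * y0 + rho * sin x ^+ 2 * z.2).
have A_disk (x : R) (z : R * R) : z.1 ^+ 2 + z.2 ^+ 2 <= 1 -> unit_disk (A x z).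
  move=> z1; rewrite /unit_disk /A /=.
  have := cos2Dsin2 x; have := sqr_ge0 (cos x); have := sqr_ge0 (sin x).
  move: (cos x ^+ 2) (sin x ^+ 2) => a b b0 a0 ab.
  have -> : (rho * a * x0 + rho * b * z.1) ^+ 2 + (rho * a * y0 + rho * b * z.2) ^+ 2
     = rho ^+ 2 * (a * (x0 ^+ 2 + y0 ^+ 2) + b * (z.1 ^+ 2 + z.2 ^+ 2) -
        a * b * ((x0 - z.1) ^+ 2 + (y0 - z.2) ^+ 2)).
    by have -> : a = 1 - b; [lra|ring].
  rewrite z02; have ab0 : 0 <= a * b * ((x0 - z.1) ^+ 2 + (y0 - z.2) ^+ 2).
    by rewrite !mulr_ge0// addr_ge0// sqr_ge0.
  have r2 : r ^+ 2 <= 1 by case/andP: r01 => ? ?; nra.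
  have ar : a * r ^+ 2 <= a by rewrite ler_piMr.
  have bz : b * (z.1 ^+ 2 + z.2 ^+ 2) <= b by rewrite ler_piMr.
  have rho2 : 0 <= rho ^+ 2 < 1 by case/andP: rho01 => ? ?; apply/andP; split; nra.
  by move: rho2 => /andP[? ?]; nra.
pose psi x t := A x (cos t, sin t).
pose p := partial_x u; pose q := partial_y u.
pose P t := poisson_kernel r (theta - t).
pose k x t := P t * u (psi x t).
pose m x t := P t * (p (psi x t) * (cos t - x0) + q (psi x t) * (sin t - y0)).
pose dk x t := 2 * sin x * cos x * rho * m x t.
have psi_disk x t : unit_disk (psi x t).
  by apply: A_disk; rewrite /= cos2Dsin2.
have kd (x t : R) : is_derive x 1 (k^~ t) (dk x t).
  have c2 : is_derive x 1 (fun x : R => cos x ^+ 2) (- (2 * (sin x * cos x))).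
    apply: (is_derive_eq (is_deriveM (is_derive_cos x) (is_derive_cos x))).
    by rewrite /GRing.scale /=; ring.
  have s2 : is_derive x 1 (fun x : R => sin x ^+ 2) (2 * (sin x * cos x)).
    apply: (is_derive_eq (is_deriveM (is_derive_sin x) (is_derive_sin x))).
    by rewrite /GRing.scale /=; ring.
  have coord (v w : R) : is_derive x 1
      (fun x : R => rho * cos x ^+ 2 * v + rho * sin x ^+ 2 * w)
      (2 * sin x * cos x * rho * (w - v)).
    have cv := is_deriveM (is_deriveM (is_derive_cst rho x 1) c2) (is_derive_cst v x 1).
    have sw := is_deriveM (is_deriveM (is_derive_cst rho x 1) s2) (is_derive_cst w x 1).
    apply: (is_derive_eq (is_deriveD cv sw)).
    by rewrite !fctE /GRing.scale /=; ring.
  have ud : is_diff (psi x t) u (fun v => v.1 * p (psi x t) + v.2 * q (psi x t)).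
    split; first exact: hu1.
    by apply/funext => v; rewrite (diff_coordRE v (hu1 _ (psi_disk x t))).
  have := @is_derive_curve _ u _ (fun x => rho * cos x ^+ 2 * x0 + rho * sin x ^+ 2 * cos t)
    (fun x => rho * cos x ^+ 2 * y0 + rho * sin x ^+ 2 * sin t) _ _ _ ud (coord x0 (cos t)) (coord y0 (sin t)).
  move=> dku; apply: (is_derive_eq (is_deriveM (is_derive_cst (P t) x 1) dku)).
  by rewrite /dk /m /GRing.scale /=; move: (p _) (q _) (P t) (u _) => *; ring.
have cP : continuous P by apply: continuous_subl; exact: continuous_poisson_kernel.
have cpsi (h : R * R -> R) : (forall z, unit_disk z -> {for z, continuous h}) ->
    continuous (fun z : R * R => h (psi z.1 z.2)).
  move=> ch z; apply: cvg_comp_pair; first exact/ch/psi_disk.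
    apply: cvgD; last first.
      apply: cvgM; last by apply: cvg_comp_cos; exact: cvg_snd.
      apply: cvgM; first exact: cvg_cst.
      by apply: cvgM; apply: cvg_comp_sin; exact: cvg_fst.
    apply: cvgM; last exact: cvg_cst.
    apply: cvgM; first exact: cvg_cst.
    by apply: cvgM; apply: cvg_comp_cos; exact: cvg_fst.
  apply: cvgD; last first.
    apply: cvgM; last by apply: cvg_comp_sin; exact: cvg_snd.
    apply: cvgM; first exact: cvg_cst.
    by apply: cvgM; apply: cvg_comp_sin; exact: cvg_fst.
  apply: cvgM; last exact: cvg_cst.
  apply: cvgM; first exact: cvg_cst.
  by apply: cvgM; apply: cvg_comp_cos; exact: cvg_fst.
have cu := cpsi u (fun z z1 => differentiable_continuous (hu1 z z1)).
have cp := cpsi p (fun z z1 => differentiable_continuous (hu2 z z1 (1, 0))).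
have cq := cpsi q (fun z z1 => differentiable_continuous (hu2 z z1 (0, 1))).
have ck x : continuous (k x).
  move=> t; apply: cvgM; first exact: cP.
  exact: (continuous_pairr (k := fun z => u (psi z.1 z.2))).
have cm : continuous (fun z : R * R => m z.1 z.2).
  move=> z; apply: cvgM.
    by apply: continuous_cvg; [exact: cP|exact: cvg_snd].
  apply: cvgD; apply: cvgM; [exact: cp| |exact: cq|].
    by apply: cvgB; [apply: cvg_comp_cos; exact: cvg_snd|exact: cvg_cst].
  by apply: cvgB; [apply: cvg_comp_sin; exact: cvg_snd|exact: cvg_cst].
have cdk : continuous (fun z : R * R => dk z.1 z.2).
  move=> z; apply: cvgM; last exact: cm.
  apply: cvgM; last exact: cvg_cst.
  apply: cvgM; last by apply: cvg_comp_cos; exact: cvg_fst.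
  apply: cvgM; first exact: cvg_cst.
  by apply: cvg_comp_sin; exact: cvg_fst.
have dk0 x : turn_integral (dk x) = 0.
  have cmx : continuous (m x) by exact: (continuous_pairr (k := fun z => m z.1 z.2)).
  rewrite (turn_integral_mulrl _ cmx).
  pose a := rho * cos x ^+ 2 * x0; pose b := rho * cos x ^+ 2 * y0.
  pose l := rho * sin x ^+ 2.
  have hg (z : R * R) : z.1 ^+ 2 + z.2 ^+ 2 <= 1 ->
    [/\ hol (fun z => p (a + l * z.1, b + l * z.2)) (fun z => - q (a + l * z.1, b + l * z.2))
      (fun z => l * partial_x p (a + l * z.1, b + l * z.2))
      (fun z => l * - partial_x q (a + l * z.1, b + l * z.2)) z,
     {for z, continuous (fun z => l * partial_x p (a + l * z.1, b + l * z.2))} &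
     {for z, continuous (fun z => l * - partial_x q (a + l * z.1, b + l * z.2))}].
    move=> z1; have Az := A_disk x z z1.
    have ca : a + l * z.1 @[z --> z] --> a + l * z.1.
      by apply: cvgD; [exact: cvg_cst|apply: cvgM; [exact: cvg_cst|exact: cvg_fst]].
    have cb : b + l * z.2 @[z --> z] --> b + l * z.2.
      by apply: cvgD; [exact: cvg_cst|apply: cvgM; [exact: cvg_cst|exact: cvg_snd]].
    have [_ _ cuu] := hu.1 _ Az.
    split; first exact: (hol_affine (harmonic_gradient_hol hu Az)).
      apply: cvgM; first exact: cvg_cst.
      by apply: cvg_comp_pair; [exact: cuu|exact: ca|exact: cb].
    apply: cvgM; first exact: cvg_cst.
    by apply: cvgN; apply: cvg_comp_pair; [exact: cuu|exact: ca|exact: cb].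
  have I0 := turn_integral_kernel_mul hg.
  have r2 : 1 - r ^+ 2 != 0 by case/andP: r01 => ? ?; rewrite gt_eqF//; nra.
  have mE (t : R) : (p (a + l * (cos t, sin t).1, b + l * (cos t, sin t).2) * (cos t - x0) -
      - q (a + l * (cos t, sin t).1, b + l * (cos t, sin t).2) * (sin t - y0)) /
      (1 - 2 * r * cos (theta - t) + r ^+ 2) = (1 - r ^+ 2)^-1 * m x t.
    have N0 : 1 - 2 * r * cos (theta - t) + r ^+ 2 != 0.
      by rewrite gt_eqF// poisson_denominator_gt0.
    rewrite /m /P /poisson_kernel; change (a + _, b + _) with (psi x t).
    move: (p _) (q _) (cos t) (sin t) (cos (theta - t)) N0 r2 => X Y C S K N0 r2.
    by field; rewrite N0.
  move: I0; rewrite (eq_turn_integral mE) (turn_integral_mulrl _ cmx) => /eqP.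
  by rewrite mulf_eq0 invr_eq0 (negbTE r2) /= => /eqP ->; rewrite mulr0.
have := turn_integral_cst_param kd ck cdk dk0 (pi / 2) 0.
have -> : turn_integral (k 0) = 2 * pi * u (polar (rho * r) theta).
  rewrite -[in RHS]turn_integral_poisson_kernel mulrC -turn_integral_mulrl; last first.
    by apply: continuous_subl; exact: continuous_poisson_kernel.
  apply: eq_turn_integral => t; rewrite /k mulrC; congr (u _ * _).
  by rewrite /psi /A /= sin0 cos0 expr0n expr1n /polar /x0 /y0 /=; congr (_, _); ring.
move=> <-; apply: eq_turn_integral => t; congr (_ * u _).
by rewrite /psi /A /= sin_pihalf cos_pihalf expr0n expr1n /polar /=; congr (_, _); ring.
Qed.
End Kernel.
End Poisson.

(** * Bochner integrals of continuous functions on the circle *)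

Section CircleMeasure.
Context (R : realType).
Notation mu := (@circle_measure R).
Notation I := (@turn R).

Lemma circle_integralE (f : R -> R) : continuous f ->
  \int[mu]_t f t = (2 * pi)^-1 * turn_integral f.
Proof.
move=> cf.
have mf : measurable_fun setT (EFin \o f : measurableTypeR R -> \bar R).
  by apply/measurable_EFinP; exact: continuous_measurable_fun.
have fi := turn_integrable cf.
rewrite /turn_integral /Rintegral integralE.
have Ip := integral_uniform (two_pi_gt0 R) (measurable_funepos mf) (fun x => funepos_ge0 _ x).
have In := integral_uniform (two_pi_gt0 R) (measurable_funeneg mf) (fun x => funeneg_ge0 _ x).
rewrite Ip In.
rewrite subr0 [in RHS]integralE.
rewrite -(fineK (integrable_pos_fin_num (@measurable_turn R) fi)).
rewrite -(fineK (integrable_neg_fin_num (@measurable_turn R) fi)).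
by rewrite -!EFinM -!EFinB /= mulrBr.
Qed.

Lemma circle_measure_outside : mu (~` I) = 0%E.
Proof.
have mt : measurable (~` I : set (measurableTypeR R)).
  by apply: measurableC; exact: measurable_turn.
rewrite -[LHS](_ : (\int[mu]_t (\1_(~` I) t)%:E)%E = _); last first.
  by rewrite integral_indic// setIT.
have mi : measurable_fun setT (fun t : measurableTypeR R => (\1_(~` I) t : R)%:E).
  by apply/measurable_EFinP; exact: measurable_indic.
have i0 (t : measurableTypeR R) : (0 <= (\1_(~` I) t : R)%:E)%E by rewrite lee_fin.
have -> := integral_uniform (two_pi_gt0 R) mi i0.
rewrite [X in (_ * X)%E](_ : _ = 0%E) ?mule0//; apply: integral0_eq => t It.
by rewrite indicE memNset// => /(_ It).
Qed.

Context (H : normedModType R).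

Definition grid (n : nat) (t : R) : nat := Num.truncn (n.+1%:R * t).

Lemma grid_eq (n k : nat) (t : R) : 0 <= t ->
  (grid n t == k) = (k%:R / n.+1%:R <= t < k.+1%:R / n.+1%:R).
Proof.
move=> t0; rewrite /grid truncn_eq; last by rewrite mulr_ge0.
by rewrite ler_pdivrMr// ltr_pdivlMr// mulrC.
Qed.

(** The value of [f] at the grid point just below [t]; it is set to zero outside
    one turn, a null set, so that the range is finite. *)
Definition staircase (f : R -> H) (n : nat) (t : R) : H :=
  if t \in I then f ((grid n t)%:R / n.+1%:R) else 0.

Lemma simple_staircase (f : R -> H) (n : nat) :
  simple_function (staircase f n : measurableTypeR R -> H).
Proof.
split.
  pose K := (grid n (2 * pi)).+1.
  apply: (@sub_finite_set _ _ ([set 0] `|` [set f (k%:R / n.+1%:R) | k in `I_K])).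
    move=> _ [t _ <-]; rewrite /staircase; case: ifPn => [/set_mem|_]; last by left.
    rewrite /turn /= in_itv /= => /andP[t0 tp]; right.
    exists (grid n t) => //=.
    by rewrite /K ltnS; apply: le_truncn; rewrite ler_wpM2l.
  by rewrite finite_setU; split => //; exact: finite_image.
move=> y.
rewrite (_ : staircase f n @^-1` [set y] =
  (~` I `&` (if 0 == y then setT else set0)) `|`
   \bigcup_k (if f (k%:R / n.+1%:R) == y then
        I `&` `[k%:R / n.+1%:R, k.+1%:R / n.+1%:R[%classic else set0)).
  apply: measurableU.
    apply: measurableI; first by apply: measurableC; exact: measurable_turn.
    by case: ifP.
  apply: bigcup_measurable => k _; case: ifP => // _.
  by apply: measurableI; [exact: measurable_turn|exact: measurable_itv].
have I0 t : I t -> 0 <= t by rewrite /turn /= in_itv /= => /andP[].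
apply/seteqP; split=> t /=.
  rewrite /staircase; case: ifPn => [/set_mem It|/negP nIt] /eqP fE.
    right; exists (grid n t) => //; rewrite fE; split => //=.
    by rewrite in_itv /= -grid_eq// I0.
  by left; rewrite fE; split => // /mem_set.
rewrite /staircase => -[[nIt]|[k _]].
  by rewrite memNset//; case: eqVneq.
case: eqVneq => // <- [It /=]; rewrite in_itv /= -grid_eq ?I0// => /eqP <-.
by rewrite mem_set.
Qed.

Lemma grid_near (n : nat) (t : R) : 0 <= t -> `|t - (grid n t)%:R / n.+1%:R| <= n.+1%:R^-1.
Proof.
move=> t0; have := eqxx (grid n t); rewrite {1}grid_eq// => /andP[h1 h2].
rewrite ger0_norm ?subr_ge0// lerBlDl.
by rewrite -natr1 mulrDl mul1r in h2; exact: ltW.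
Qed.

Lemma cvg_staircase (f : R -> H) (t : R) : {for t, continuous f} -> I t ->
  staircase f n t @[n --> \oo] --> f t.
Proof.
move=> cf It; have t0 : 0 <= t by move: It; rewrite /turn /= in_itv /= => /andP[].
rewrite /staircase mem_set//.
have gt : (grid n t)%:R / n.+1%:R @[n --> \oo] --> t.
  apply/cvgrPdist_le => e e0; near=> n.
  apply: (le_trans (grid_near n t0)).
  by apply/ltW; near: n; exact: (near_infty_natSinv_lt (PosNum e0)).
exact: (continuous_cvg _ cf gt).
Unshelve. all: by end_near. Qed.

Let ae_filter : Filter (nbhs (almost_everywhere mu)).
Proof. exact: ae_filter_ringOfSetsType. Qed.

Lemma ae_turn : {ae mu, forall t : R, I t}.
Proof.
exists (~` I); split; [|exact: circle_measure_outside|by []].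
by apply: measurableC; exact: measurable_turn.
Qed.

Lemma strongly_measurable_continuous (f : R -> H) :
  continuous f -> strongly_measurable mu f.
Proof.
move=> cf; exists (staircase f); first exact: simple_staircase.
apply: (@filterS _ _ ae_filter) ae_turn => t It.
by apply: cvg_staircase => //; exact: cf.
Qed.

Variable dot : {dot H for idfun}.
Hypothesis Hdot : norm_from_dot dot.

(** To recognize the Bochner integral it suffices to know it weakly: the
    error [h] made by a step function is tested against itself, which bounds its
    norm by an integral that tends to zero. *)
Lemma is_bochner_integral_continuous (f : R -> H) (v : H) (M : R) :
  continuous f -> (forall t, `|f t| <= M) ->
  (forall h, \int[mu]_t dot (f t) h = dot v h) ->
  is_bochner_integral mu f v.
Proof.
move=> cf fM fv.
have sg n := simple_staircase f n.
have gf : {ae mu, forall t, staircase f n t @[n --> \oo] --> f t}.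
  by apply: (@filterS _ _ ae_filter) ae_turn => t It; apply: cvg_staircase => //; exact: cf.
split; first exact: strongly_measurable_continuous.
have mfy (y : H) : measurable_fun setT (fun t : R => `|f t - y|).
  apply: continuous_measurable_fun => t; apply: cvg_norm.
  by apply: cvgB; [exact: cf|exact: cvg_cst].
pose w n t : \bar R := `|f t - staircase f n t|%:E.
have mw n : measurable_fun setT (w n : measurableTypeR R -> \bar R).
  apply/measurable_EFinP.
  have := @measurable_fun_simple _ _ _ _ (staircase f n) (fun t y => `|f t - y|) (sg n) mfy.
  exact.
have stM n t : `|staircase f n t| <= M.
  by rewrite /staircase; case: ifP => _ //; rewrite normr0 (le_trans _ (fM t)).
have w0 : (\int[mu]_t w n t)%E @[n --> \oo] --> 0%E.
  have iM : mu.-integrable setT (EFin \o cst (M + M)).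
    exact: (@bounded_integrable _ _ _ _ _ `|M + M|).
  have wc : {ae mu, forall t, setT t -> w n t @[n --> \oo] --> 0%E}.
    apply: (@filterS _ _ ae_filter) gf => t ft _; apply: cvg_EFin; first exact: nearW.
    apply/cvgrPdist_le => e e0; have /cvgrPdist_le/(_ e e0) := ft.
    by apply: filterS => n; rewrite /= sub0r normrN normr_id.
  have wb : {ae mu, forall t n, setT t -> (`|w n t| <= (EFin \o cst (M + M)%R) t)%E}.
    apply: aeW => t n _; rewrite /w /= normr_id lee_fin.
    by rewrite (le_trans (ler_normB _ _))// lerD.
  have [_ _] := dominated_convergence measurableT mw (measurable_cst _) wc iM wb.
  by rewrite integral0.
exists (staircase f); split=> //.
apply/cvgrPdist_le => e e0; near=> n.
have we : (\int[mu]_t w n t <= e%:E)%E by near: n; exact: cvge0_near_le.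
rewrite distrC; set h := _ - v.
have [->|h0] := eqVneq h 0; first by rewrite normr0 ltW.
have hp : 0 < `|h| by rewrite normr_gt0.
rewrite -(ler_pM2l hp) -expr2 -(dotxx Hdot) {1}/h dotBl.
rewrite -fv -(dot_simple_integral mu dot)//.
have idf (g : R -> H) : measurable_fun setT (fun t => dot (g t) h) -> (forall t, `|g t| <= M) ->
    mu.-integrable setT (EFin \o fun t => dot (g t) h).
  move=> mg gM; apply: (@bounded_integrable _ _ _ _ _ (M * `|h|)) => // t.
  by rewrite (le_trans (normr_dot_le Hdot _ _))// ler_wpM2r.
have i1 : mu.-integrable setT (EFin \o fun t => dot (staircase f n t) h).
  have mh (y : H) : measurable_fun setT (fun _ : R => dot y h) by exact: measurable_cst.
  have := @measurable_fun_simple _ _ _ _ (staircase f n) (fun _ y => dot y h) (sg n) mh.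
  by move=> ms; apply: idf.
have i2 : mu.-integrable setT (EFin \o fun t => dot (f t) h).
  by apply: idf => //; apply: continuous_measurable_fun => t; apply: (cvg_dotl Hdot); exact: cf.
rewrite -RintegralB//; apply: (le_trans (ler_norm _)).
have w_ge0 t : (0 <= w n t)%E by rewrite lee_fin.
have wh : {ae mu, forall t,
    (`|dot (staircase f n t) h - dot (f t) h|%:E <= `|h|%:E * w n t)%E}.
  apply: aeW => t; rewrite /w -EFinM lee_fin -dotBl (distrC (f t)) mulrC.
  exact: (normr_dot_le Hdot).
exact: (normr_Rintegral_le hp (integrable_subr i1 i2) w_ge0 wh we).
Unshelve. all: by end_near. Qed.
End CircleMeasure.

(** * Harmonic maps: criterion, linear changes of variable, dilations *)

Section HarmonicIntro.
Context (R : realType) (H : normedModType R).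

Lemma near_eq_differentiable (V W : normedModType R) (f g : V -> W) (z : V) :
  {near z, f =1 g} -> differentiable f z -> differentiable g z.
Proof.
move=> fg df.
have fz : f z = g z by exact: nbhs_singleton fg.
have g_eq : g \o shift z = cst (g z) + 'd f z +o_ 0 id.
  apply/eqaddoP => e e0; have /eqaddoP/(_ e e0) := diff_locally df.
  apply: filterS2; last first.
    have : \forall w \near 0, f (w + z) = g (w + z).
      move: fg => /nbhs0P; apply: filterS => w; rewrite addrC; exact.
    exact.
  by move=> w /= fgw; rewrite !fctE /= fgw fz.
have dE : 'd g z = 'd f z :> (V -> W) by apply: diff_unique => //; exact: diff_continuous.
by apply/diff_locallyP; rewrite dE; split => //; exact: diff_continuous.
Qed.

Lemma near_eq_continuous (V W : topologicalType) (f g : V -> W) (z : V) :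
  {near z, f =1 g} -> {for z, continuous f} -> {for z, continuous g}.
Proof.
move=> fg cf; rewrite /prop_for /continuous_at -(nbhs_singleton fg).
by apply: cvg_trans cf; exact: near_eq_cvg.
Qed.

(** Derivatives need only be exhibited on the open disk, by closed formulas [D] and
    [D2]; they then agree with the true derivatives near every point of it. *)
Lemma harmonic_on_disk_intro (F : R * R -> H) (D : R * R -> R * R -> H)
    (D2 : R * R -> R * R -> R * R -> H) :
  (forall z, unit_disk z -> [/\ differentiable F z,
     forall v, 'D_v F z = D v z,
     forall v, differentiable (D v) z,
     forall u v, 'D_u (D v) z = D2 u v z &
     forall u v, {for z, continuous (D2 u v)}]) ->
  (forall z, unit_disk z -> D2 (1, 0) (1, 0) z + D2 (0, 1) (0, 1) z = 0) ->
  harmonic_on_disk F.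
Proof.
move=> FD lap.
have DF v z : unit_disk z -> {near z, 'D_v F =1 D v}.
  by move=> z1; apply: filterS (unit_disk_nbhs z1) => w /FD[].
have D2F u v z : unit_disk z -> 'D_u ('D_v F) z = D2 u v z.
  move=> z1; have [_ _ dD <- _] := FD z z1.
  have [u0|u0] := eqVneq u 0; first by rewrite u0 !derive0.
  by apply: near_eq_derive => //; exact: DF.
split.
  move=> z z1; have [dF _ dD _ cD2] := FD z z1.
  split => // [v|u v].
    apply: (near_eq_differentiable _ (dD v)).
    by apply: filterS (DF v z z1) => w ->.
  apply: (near_eq_continuous _ (cD2 u v)).
  by apply: filterS (unit_disk_nbhs z1) => w w1; rewrite D2F.
by move=> z z1; rewrite /laplacian /partial_x /partial_y !D2F// lap.
Qed.

Lemma derive_coord (g : R * R -> H) (w v : R * R) : differentiable g w ->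
  'D_v g w = v.1 *: 'D_((1, 0) : R * R) g w + v.2 *: 'D_((0, 1) : R * R) g w.
Proof. by move=> dg; rewrite -diff_coordE// deriveE. Qed.

Lemma derive2_coord (F : R * R -> H) (w u v : R * R) : C2_on_disk F -> unit_disk w ->
  'D_u ('D_v F) w = v.1 *: 'D_u ('D_((1, 0) : R * R) F) w +
                    v.2 *: 'D_u ('D_((0, 1) : R * R) F) w.
Proof.
move=> C2F w1; have [_ ddF _] := C2F w w1.
have [->|u0] := eqVneq u 0; first by rewrite !derive0 !scaler0 addr0.
have dx := diff_derivable (v := u) (ddF (1, 0)).
have dy := diff_derivable (v := u) (ddF (0, 1)).
have [_ <-] := is_deriveD (is_deriveZ v.1 (derivableP dx)) (is_deriveZ v.2 (derivableP dy)).
apply: near_eq_derive => //.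
by apply: filterS (unit_disk_nbhs w1) => z /C2F[dF _ _]; rewrite derive_coord.
Qed.

Lemma derive2_diag (F : R * R -> H) (w : R * R) (x y : R) : C2_on_disk F -> unit_disk w ->
  'D_((x, y) : R * R) ('D_((x, y) : R * R) F) w =
   (x ^+ 2) *: partial_x (partial_x F) w + (x * y) *: (partial_y (partial_x F) w +
     partial_x (partial_y F) w) + (y ^+ 2) *: partial_y (partial_y F) w.
Proof.
move=> C2F w1; have [_ ddF _] := C2F w w1.
have E0 := derive2_coord (x, y) (x, y) C2F w1.
have Ex := derive_coord (x, y) (ddF (1, 0)).
have Ey := derive_coord (x, y) (ddF (0, 1)).
transitivity (x *: (x *: partial_x (partial_x F) w + y *: partial_y (partial_x F) w) +
              y *: (x *: partial_x (partial_y F) w + y *: partial_y (partial_y F) w)).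
  apply: (eq_trans E0).
  exact: (congr2 +%R (congr1 ( *:%R x) Ex) (congr1 ( *:%R y) Ey)).
move: (partial_x (partial_x F) w) (partial_y (partial_x F) w)
  (partial_x (partial_y F) w) (partial_y (partial_y F) w) => a b c d.
by rewrite !scalerDr !scalerA -!expr2 (mulrC y x) !addrA.
Qed.

Lemma lin_laplacian_eq0 (a b c : H) (al be ga de : R) :
  al ^+ 2 + be ^+ 2 = ga ^+ 2 + de ^+ 2 -> al * ga + be * de = 0 -> a + b = 0 ->
  (al ^+ 2 *: a + (al * ga) *: c + ga ^+ 2 *: b) +
  (be ^+ 2 *: a + (be * de) *: c + de ^+ 2 *: b) = 0.
Proof.
move=> n0 o0 /eqP; rewrite addr_eq0 => /eqP ->.
rewrite addrACA (addrACA (al ^+ 2 *: _)) -!scalerDl o0 scale0r addr0 n0 scalerN.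
by rewrite addNr.
Qed.

(** The linear map of the plane with matrix rows [(al, be)] and [(ga, de)]. *)
Definition lin2 (al be ga de : R) (z : R * R) : R * R :=
  (al * z.1 + be * z.2, ga * z.1 + de * z.2).

Lemma is_diff_lin2 al be ga de z : is_diff z (lin2 al be ga de) (lin2 al be ga de).
Proof.
have f1 := is_diff_fst z; have f2 := is_diff_snd z.
apply: (is_diff_eq (is_diff_pair (is_diffD (is_diffZ al f1) (is_diffZ be f2))
  (is_diffD (is_diffZ ga f1) (is_diffZ de f2)))).
by [].
Qed.

Lemma derive_lin2 (F : R * R -> H) al be ga de z v :
  let L := lin2 al be ga de in differentiable F (L z) ->
  differentiable (F \o L) z /\ 'D_v (F \o L) z = 'D_(L v) F (L z).
Proof.
move=> L dF; have [D E] := is_diff_comp (f := L) (g := F) (is_diff_lin2 al be ga de z) (differentiableP dF).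
by split=> //; rewrite deriveE// E deriveE.
Qed.

(** The hypotheses say that the matrix is a similarity, which makes the mixed
    second derivatives cancel in the Laplacian. *)
Lemma harmonic_lin2 (F : R * R -> H) al be ga de :
  let L := lin2 al be ga de in
  al ^+ 2 + be ^+ 2 = ga ^+ 2 + de ^+ 2 -> al * ga + be * de = 0 ->
  (forall z, unit_disk z -> unit_disk (L z)) ->
  harmonic_on_disk F -> harmonic_on_disk (F \o L).
Proof.
move=> L n0 o0 L1 [C2F lapF].
apply: (@harmonic_on_disk_intro _ (fun v z => 'D_(L v) F (L z))
  (fun u v z => 'D_(L u) ('D_(L v) F) (L z))).
  move=> z z1; have Lz1 := L1 z z1; have [dF ddF cF] := C2F _ Lz1.
  split.
  - by have [] := derive_lin2 0 dF.
  - by move=> v; have [] := derive_lin2 v dF.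
  - by move=> v; have [] := derive_lin2 0 (ddF (L v)).
  - by move=> u v; have [] := derive_lin2 u (ddF (L v)).
  - move=> u v; apply: (@continuous_comp _ _ _ L ('D_(L u) ('D_(L v) F))); last exact: cF.
    by apply: differentiable_continuous; case: (is_diff_lin2 al be ga de z).
move=> z z1; have Lz1 := L1 z z1; have [dF ddF cF] := C2F _ Lz1.
have L10 : L (1, 0) = (al, ga) by rewrite /L /lin2 /= !mulr1 !mulr0 !addr0.
have L01 : L (0, 1) = (be, de) by rewrite /L /lin2 /= !mulr1 !mulr0 !add0r.
rewrite L10 L01 (derive2_diag al ga C2F Lz1) (derive2_diag be de C2F Lz1).
exact: lin_laplacian_eq0 n0 o0 (lapF _ Lz1).
Qed.

End HarmonicIntro.

Section HarmonicDot.
Context (R : realType) (H : normedModType R) (dot : {dot H for idfun}).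
Hypothesis Hdot : norm_from_dot dot.

Lemma harmonic_dot (F : R * R -> H) (h : H) :
  harmonic_on_disk F -> harmonic_on_disk (fun z => dot (F z) h : R).
Proof.
move=> [C2F lapF].
apply: (@harmonic_on_disk_intro _ _ _ (fun v z => dot ('D_v F z) h)
  (fun u v z => dot ('D_u ('D_v F) z) h)).
  move=> z z1; have [dF ddF cF] := C2F _ z1; split.
  - exact: differentiable_dotl.
  - by move=> v; rewrite (derive_dotl Hdot)//; exact: diff_derivable.
  - by move=> v; exact: differentiable_dotl.
  - by move=> u v; rewrite (derive_dotl Hdot)//; exact: diff_derivable.
  - by move=> u v; apply: (cvg_dotl Hdot); exact: cF.
move=> z z1; have E : dot (laplacian F z) h = 0 by rewrite lapF// linear0l.
by rewrite -dotDl; exact: E.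
Qed.

(** The boundary values of a dilated map are continuous, so the Poisson
    representation can be checked weakly, where it is the scalar Poisson
    formula. *)
Lemma boundary_function_dilation (F : R * R -> H) (rho M : R) :
  0 <= rho < 1 -> harmonic_on_disk F -> (forall z, unit_disk z -> `|F z| <= M) ->
  boundary_function (F \o lin2 rho 0 0 rho) (F \o lin2 rho 0 0 rho).
Proof.
move=> rho01 hF FM.
have polE r t : lin2 rho 0 0 rho (polar r t) = polar (rho * r) t.
  by rewrite /lin2 /polar /= !mul0r addr0 add0r !mulrA.
have disk t : unit_disk (polar rho t : R * R).
  rewrite /unit_disk /polar /= !exprMn -mulrDr cos2Dsin2 mulr1.
  by case/andP: rho01 => ? ?; nra.
pose f t := F (polar rho t).
have cf : continuous f.
  move=> t; apply: cvg_comp_pair.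
  - by apply: differentiable_continuous; have [] := hF.1 _ (disk t).
  - by apply: cvgM; [exact: cvg_cst|exact: continuous_cos].
  - by apply: cvgM; [exact: cvg_cst|exact: continuous_sin].
have fM t : `|f t| <= M by apply: FM; exact: disk.
have fE : (fun t : R => (F \o lin2 rho 0 0 rho) (polar 1 t)) = f.
  by apply/funext => t; rewrite /= polE mulr1.
split.
  rewrite fE; split; last by exists M; apply: aeW => t; exact: fM.
  exact: strongly_measurable_continuous.
move=> r theta r01.
have gE : (fun t : R => poisson_kernel r (theta - t) *: (F \o lin2 rho 0 0 rho) (polar 1 t)) =
    fun t => poisson_kernel r (theta - t) *: f t.
  by apply/funext => t; rewrite /= polE mulr1.
rewrite gE [X in is_bochner_integral _ _ X]/= polE.
have cP : continuous (fun t => poisson_kernel r (theta - t)).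
  by apply: continuous_subl; exact: continuous_poisson_kernel.
apply: (@is_bochner_integral_continuous _ _ _ Hdot _ _ ((1 - r ^+ 2) / (1 - r) ^+ 2 * M)).
- by move=> t; apply: cvgZ; [exact: cP|exact: cf].
- move=> t; have /andP[P0 PB] := poisson_kernel_bounds (theta - t) r01.
  by rewrite normrZ ger0_norm// ler_pM.
move=> h; have hu := harmonic_dot h hF.
have cfh : continuous (fun t => dot (f t) h) by move=> t; apply: (cvg_dotl Hdot); exact: cf.
have PF : turn_integral (fun t => poisson_kernel r (theta - t) * dot (f t) h) =
    2 * pi * dot (F (polar (rho * r) theta)) h := poisson_formula theta r01 rho01 hu.
have E t : dot (poisson_kernel r (theta - t) *: f t) h = poisson_kernel r (theta - t) * dot (f t) h.
  exact: dotZl.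
transitivity (\int[@circle_measure R]_t (poisson_kernel r (theta - t) * dot (f t) h)).
  by apply: eq_Rintegral => t _; exact: E.
rewrite circle_integralE; last by move=> t; apply: cvgM; [exact: cP|exact: cfh].
by rewrite PF mulKf// gt_eqF// two_pi_gt0.
Qed.

End HarmonicDot.

(** * Harmonic maps into a plane and the disk automorphism *)

Section HolomorphicDisk.
Context (R : realType) (H : normedModType R).

Lemma near_eq_is_diff (V W : normedModType R) (f g df : V -> W) (z : V) :
  {near z, f =1 g} -> is_diff z f df -> is_diff z g df.
Proof.
move=> fg [dfz <-]; have dg := near_eq_differentiable fg dfz.
split; first exact: dg.
apply/funext => v; have [->|v0] := eqVneq v 0; first by rewrite !linear0.
apply: (eq_trans (esym (deriveE v dg))); apply: (eq_trans _ (deriveE v dfz)).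
by apply: near_eq_derive => //; apply: filterS fg => w ->.
Qed.

Lemma is_diff_Zl (V : normedModType R) (k dk : V -> R) (e : H) (z : V) :
  is_diff z k dk -> is_diff z (fun x => k x *: e) (fun u => dk u *: e).
Proof. by move=> [dkz <-]; split; [exact: differentiableZl|rewrite diffZl]. Qed.

Lemma is_diff_derive (V W : normedModType R) (f df : V -> W) (z v : V) :
  is_diff z f df -> 'D_v f z = df v.
Proof. by move=> [dfz <-]; rewrite deriveE. Qed.

(** The holomorphic function [f + i g] placed in the affine plane through [q]
    spanned by [e1] and [e2]. *)
Definition plane_map (q e1 e2 : H) (f g : R * R -> R) (z : R * R) : H :=
  q + f z *: e1 + g z *: e2.

Lemma is_diff_plane_map (q e1 e2 : H) (f g f' g' : R * R -> R) (z : R * R) :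
  hol f g f' g' z -> is_diff z (plane_map q e1 e2 f g)
    (fun u => (f' z * u.1 - g' z * u.2) *: e1 + (g' z * u.1 + f' z * u.2) *: e2).
Proof.
move=> [F G].
apply: (is_diff_eq (is_diffD (is_diffD (is_diff_cst q z) (is_diff_Zl e1 F)) (is_diff_Zl e2 G))).
by apply/funext => u; rewrite !fctE add0r.
Qed.

Lemma harmonic_plane_map (q e1 e2 : H) (f g f' g' f2 g2 : R * R -> R) :
  (forall z, unit_disk z -> [/\ hol f g f' g' z, hol f' g' f2 g2 z,
     {for z, continuous f2} & {for z, continuous g2}]) ->
  harmonic_on_disk (plane_map q e1 e2 f g).
Proof.
move=> fh.
pose D (v z : R * R) : H := (f' z * v.1 - g' z * v.2) *: e1 + (g' z * v.1 + f' z * v.2) *: e2.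
pose D2 (u v z : R * R) : H :=
  ((f2 z * u.1 - g2 z * u.2) * v.1 - (g2 z * u.1 + f2 z * u.2) * v.2) *: e1 +
  ((g2 z * u.1 + f2 z * u.2) * v.1 + (f2 z * u.1 - g2 z * u.2) * v.2) *: e2.
have DD (v z : R * R) : unit_disk z -> is_diff z (D v) (fun u => D2 u v z).
  move=> /fh[_ [F G] _ _].
  have h1 := is_diffB (is_diffZ v.1 F) (is_diffZ v.2 G).
  have h2 := is_diffD (is_diffZ v.1 G) (is_diffZ v.2 F).
  have := is_diffD (is_diff_Zl e1 h1) (is_diff_Zl e2 h2).
  have -> : (fun x => (v.1 *: f' - v.2 *: g') x *: e1) + (fun x => (v.1 *: g' + v.2 *: f') x *: e2) = D v.
    apply/funext => w; rewrite /D !fctE /GRing.scale /=.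
    by rewrite ![v.1 * _]mulrC ![v.2 * _]mulrC.
  move=> h; apply: (is_diff_eq h); apply/funext => u; rewrite /D2 !fctE.
  by congr (_ *: _ + _ *: _); rewrite /GRing.scale /=; ring.
apply: (@harmonic_on_disk_intro _ _ _ D D2).
  move=> z z1; have [hF _ cf cg] := fh z z1; split.
  - by case: (is_diff_plane_map q e1 e2 hF).
  - by move=> v; rewrite (is_diff_derive _ (is_diff_plane_map q e1 e2 hF)).
  - by move=> v; case: (DD v z z1).
  - by move=> u v; rewrite (is_diff_derive _ (DD v z z1)).
  - move=> u v.
    have c1 : {for z, continuous (fun z => f2 z * u.1 - g2 z * u.2)}.
      by apply: cvgB; apply: cvgM; [exact: cf|exact: cvg_cst|exact: cg|exact: cvg_cst].
    have c2 : {for z, continuous (fun z => g2 z * u.1 + f2 z * u.2)}.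
      by apply: cvgD; apply: cvgM; [exact: cg|exact: cvg_cst|exact: cf|exact: cvg_cst].
    have c3 : {for z, continuous (fun z => (f2 z * u.1 - g2 z * u.2) * v.1 - (g2 z * u.1 + f2 z * u.2) * v.2)}.
      by apply: cvgB; apply: cvgM; [exact: c1|exact: cvg_cst|exact: c2|exact: cvg_cst].
    have c4 : {for z, continuous (fun z => (g2 z * u.1 + f2 z * u.2) * v.1 + (f2 z * u.1 - g2 z * u.2) * v.2)}.
      by apply: cvgD; apply: cvgM; [exact: c2|exact: cvg_cst|exact: c1|exact: cvg_cst].
    by apply: cvgD; [exact: (cvgZ c3 (cvg_cst _))|exact: (cvgZ c4 (cvg_cst _))].
move=> z _; transitivity ((0 : R) *: e1 + (0 : R) *: e2); last by rewrite !scale0r addr0.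
by rewrite /D2 /= addrACA -!scalerDl; congr (_ *: _ + _ *: _); ring.
Qed.

Lemma harmonic_on_disk_ext (F F' : R * R -> H) :
  (forall z, unit_disk z -> F z = F' z) -> harmonic_on_disk F -> harmonic_on_disk F'.
Proof.
move=> FF' [C2F lapF].
have nFF' z : unit_disk z -> {near z, F =1 F'}.
  by move=> z1; apply: filterS (unit_disk_nbhs z1) => w /FF'.
apply: (@harmonic_on_disk_intro _ _ _ (fun v => 'D_v F) (fun u v => 'D_u ('D_v F))) => //.
move=> z z1; have [dF ddF cF] := C2F z z1; split => //.
  exact: (near_eq_differentiable (nFF' z z1) dF).
move=> v; have [->|v0] := eqVneq v 0; first by rewrite !derive0.
by apply/esym; apply: near_eq_derive => //; exact: nFF'.
Qed.

End HolomorphicDisk.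

Section MobiusHolomorphic.
Context (R : realType).
Variable s : R.
Hypothesis s01 : 0 <= s < 1.

Let w (z : R * R) : R := (1 + s * z.1) ^+ 2 + (s * z.2) ^+ 2.
Definition mobius_re (z : R * R) : R := ((s + z.1) * (1 + s * z.1) + s * z.2 ^+ 2) / w z.
Definition mobius_im (z : R * R) : R := (1 - s ^+ 2) * z.2 / w z.

Let a (z : R * R) : R := (1 + s * z.1) / w z.
Let b (z : R * R) : R := - (s * z.2) / w z.
Definition mobius_re' (z : R * R) : R := (1 - s ^+ 2) * (a z ^+ 2 - b z ^+ 2).
Definition mobius_im' (z : R * R) : R := (1 - s ^+ 2) * (2 * a z * b z).
Let mobius_re2 (z : R * R) : R := (1 - s ^+ 2) * (- 2 * s * (a z ^+ 3 - 3 * a z * b z ^+ 2)).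
Let mobius_im2 (z : R * R) : R := (1 - s ^+ 2) * (- 2 * s * (3 * a z ^+ 2 * b z - b z ^+ 3)).

Let w_neq0 (z : R * R) : unit_disk z -> w z != 0.
Proof. by move=> z1; have := weight_gt0 s01 (ltW z1); rewrite weightE => /lt0r_neq0. Qed.

Let numerator_hol (z : R * R) : hol (fun z => s + z.1) (fun z => z.2) (cst 1) (cst 0) z.
Proof.
split.
  apply: (is_diff_eq (is_diffD (is_diff_cst s z) (is_diff_fst z))).
  by apply/funext => u; transitivity (0 + u.1) => //; rewrite /cst; ring.
apply: (is_diff_eq (is_diff_snd z)).
by apply/funext => u; transitivity (u.2) => //; rewrite /cst; ring.
Qed.

Let inverse_hol (z : R * R) : unit_disk z ->
  hol a b (fun z => cst 0 z * (2 * a z * b z) - cst s z * (a z ^+ 2 - b z ^+ 2))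
          (fun z => - cst 0 z * (a z ^+ 2 - b z ^+ 2) - cst s z * (2 * a z * b z)) z.
Proof.
move=> z1.
apply: (@hol_inv _ (fun z => 1 + s * z.1) (fun z => s * z.2)); first exact: w_neq0.
split.
  apply: (is_diff_eq (is_diffD (is_diff_cst (1 : R) z) (is_diffZ s (is_diff_fst z)))).
  by apply/funext => u; transitivity (0 + s * u.1) => //; rewrite /cst; ring.
apply: (is_diff_eq (is_diffZ s (is_diff_snd z))).
by apply/funext => u; transitivity (s * u.2) => //; rewrite /cst; ring.
Qed.

(** The automorphism is [(s + z) / (1 + s z)], with derivative
    [(1 - s^2) / (1 + s z)^2]. *)
Lemma mobius_hol (z : R * R) : unit_disk z ->
  hol mobius_re mobius_im mobius_re' mobius_im' z.
Proof.
move=> z1; have w0 := w_neq0 z1.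
have [K1 K2] := hol_mul (numerator_hol z) (inverse_hol z1).
split.
  rewrite (_ : mobius_re = fun z => (s + z.1) * a z - z.2 * b z); last first.
    by apply/funext => x; rewrite /mobius_re /a /b; ring.
  apply: (is_diff_eq K1).
  apply/funext => u; rewrite /mobius_re' /mobius_im' /a /b /w /cst.
  by move: w0; rewrite /w; move: z.1 z.2 u.1 u.2 => x y u1 u2 w0; field.
rewrite (_ : mobius_im = fun z => (s + z.1) * b z + z.2 * a z); last first.
  by apply/funext => x; rewrite /mobius_im /a /b; ring.
apply: (is_diff_eq K2).
apply/funext => u; rewrite /mobius_re' /mobius_im' /a /b /w /cst.
by move: w0; rewrite /w; move: z.1 z.2 u.1 u.2 => x y u1 u2 w0; field.
Qed.

Lemma mobius_hol2 (z : R * R) : unit_disk z ->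
  [/\ hol mobius_re' mobius_im' mobius_re2 mobius_im2 z,
    {for z, continuous mobius_re2} & {for z, continuous mobius_im2}].
Proof.
move=> z1; have K := inverse_hol z1.
have [ca cb] := hol_continuous K.
have [K1 K2] := hol_mul (hol_cst (1 - s ^+ 2) 0 z) (hol_mul K K).
split.
- split.
    rewrite (_ : mobius_re' = fun z =>
      (1 - s ^+ 2) * (a z * a z - b z * b z) - 0 * (a z * b z + b z * a z)); last first.
      by apply/funext => x; rewrite /mobius_re'; ring.
    apply: (is_diff_eq K1).
    apply/funext => u; rewrite /mobius_re2 /mobius_im2 /cst -/(w z) -/(a z) -/(b z).
    by move: (a z) (b z) u.1 u.2 => A B u1 u2; ring.
  rewrite (_ : mobius_im' = fun z =>
      (1 - s ^+ 2) * (a z * b z + b z * a z) + 0 * (a z * a z - b z * b z)); last first.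
    by apply/funext => x; rewrite /mobius_im'; ring.
  apply: (is_diff_eq K2).
  apply/funext => u; rewrite /mobius_re2 /mobius_im2 /cst -/(w z) -/(a z) -/(b z).
  by move: (a z) (b z) u.1 u.2 => A B u1 u2; ring.
- apply: cvgM; first exact: cvg_cst.
  apply: cvgM; first exact: cvg_cst.
  exact: (cvgB (cvgM ca (cvgM ca ca)) (cvgM (cvgM (cvg_cst _) ca) (cvgM cb cb))).
- apply: cvgM; first exact: cvg_cst.
  apply: cvgM; first exact: cvg_cst.
  exact: (cvgB (cvgM (cvgM (cvg_cst _) (cvgM ca ca)) cb) (cvgM cb (cvgM cb cb))).
Qed.

Lemma mobius_lt1 (z : R * R) : unit_disk z -> mobius_re z ^+ 2 + mobius_im z ^+ 2 < 1.
Proof.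
move=> z1; have w0 := w_neq0 z1.
have wp : 0 < w z by rewrite lt0r w0 addr_ge0// sqr_ge0.
rewrite -subr_gt0.
have -> : 1 - (mobius_re z ^+ 2 + mobius_im z ^+ 2) =
    (1 - s ^+ 2) * (1 - (z.1 ^+ 2 + z.2 ^+ 2)) / w z.
  move: w0; rewrite /mobius_re /mobius_im /w; move: z.1 z.2 => x y w0; field.
  exact: w0.
have s2 : 0 < 1 - s ^+ 2 by case/andP: s01 => ? ?; nra.
by rewrite divr_gt0// mulr_gt0// subr_gt0.
Qed.

Lemma mobius_re0 : mobius_re 0 = s.
Proof. by rewrite /mobius_re /w /=; field. Qed.

Lemma mobius_im0 : mobius_im 0 = 0.
Proof. by rewrite /mobius_im /w /=; field. Qed.

Lemma mobius_re'0 : mobius_re' 0 = 1 - s ^+ 2.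
Proof. by rewrite /mobius_re' /a /b /w /=; field. Qed.

Lemma mobius_im'0 : mobius_im' 0 = 0.
Proof. by rewrite /mobius_im' /a /b /w /=; field. Qed.

Lemma section_mapE (H : normedModType R) (c : R) (q e1 e2 : H) (z : R * R) : unit_disk z ->
  section_map s c q e1 e2 z = plane_map q (c *: e1) (c *: e2) mobius_re mobius_im z.
Proof.
move=> z1; have := weight_gt0 s01 (ltW z1) => /lt0r_neq0 w0.
rewrite /section_map mobiusE//= weightE /plane_map !scalerA.
by rewrite ![c * _]mulrC.
Qed.

End MobiusHolomorphic.

(** * The section disk belongs to the class *)

Section Conformal.
Context (R : realType) (H : normedModType R).

Lemma opnorm_conformal (L : R * R -> H) (lam : R) : 0 < lam ->
  (forall v, `|L v| = lam * eucl_norm v) -> opnorm L = lam.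
Proof.
move=> lam0 LE; rewrite /opnorm; set A := [set _ | _ in _].
have e10 : eucl_norm ((1, 0) : R * R) = 1.
  by rewrite /eucl_norm /= expr1n expr0n addr0 sqrtr1.
have Alam : A lam by exists (1, 0); rewrite /= ?e10// LE e10 mulr1.
have Aub : ubound A lam.
  by move=> _ [v /= v1 <-]; rewrite LE ler_piMr// ltW.
apply/eqP; rewrite eq_le; apply/andP; split.
  by apply: ge_sup => //; exists lam.
by apply: ub_le_sup => //; exists lam.
Qed.

Context (dot : {dot H for idfun}).
Hypothesis Hdot : norm_from_dot dot.

Lemma norm_orthonormal (e1 e2 : H) (x y : R) :
  dot e1 e1 = 1 -> dot e2 e2 = 1 -> dot e1 e2 = 0 ->
  `|x *: e1 + y *: e2| = eucl_norm (x, y).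
Proof.
move=> h1 h2 h12; rewrite Hdot /eucl_norm /= !(dotDl, dotDr, dotZl, dotZr).
by rewrite h1 h2 h12 (dotC dot e2) h12; congr Num.sqrt; ring.
Qed.

Lemma eucl_normZ (k : R) (v : R * R) : 0 <= k ->
  eucl_norm (k * v.1, k * v.2) = k * eucl_norm v.
Proof.
move=> k0; rewrite /eucl_norm /= !exprMn -mulrDr sqrtrM ?sqr_ge0//.
by rewrite sqrtr_sqr ger0_norm.
Qed.

Lemma diff0_conformal (F : R * R -> H) (lam : R) (e1 e2 : H) :
  dot e1 e1 = 1 -> dot e2 e2 = 1 -> dot e1 e2 = 0 -> 0 < lam ->
  (forall v, diff0 F v = lam *: (v.1 *: e1 + v.2 *: e2)) ->
  [/\ conformal (diff0 F), opnorm (diff0 F) = lam &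
    range (diff0 F) = [set w | exists x y : R, w = x *: e1 + y *: e2]].
Proof.
move=> h1 h2 h12 lam0 dF.
have nF v : `|diff0 F v| = lam * eucl_norm v.
  by rewrite dF normrZ gtr0_norm// norm_orthonormal//; case: v.
split; [by exists lam|exact: opnorm_conformal|].
apply/seteqP; split=> [_ [v _ <-]|_ [x [y ->]]].
  by exists (lam * v.1), (lam * v.2); rewrite dF scalerDr !scalerA.
exists (lam^-1 * x, lam^-1 * y) => //; rewrite dF scalerDr !scalerA /= !mulrA.
by rewrite divff ?gt_eqF// !mul1r.
Qed.

End Conformal.

Section SectionDisk.
Context (R : realType) (H : normedModType R) (dot : {dot H for idfun}).
Hypothesis Hdot : norm_from_dot dot.
Variables (G : set H) (p : H) (Lam : set H) (q : H) (a c : R) (e1 e2 : H).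
Hypothesis e_basis : orthonormal_basis dot Lam e1 e2.
Hypothesis pE : p = a *: e1 + q.
Hypothesis c_gt0 : 0 < c.
Hypothesis sc01 : 0 <= a / c < 1.
Hypothesis G_section :
  [set q + v | v in [set v | Lam v /\ `|v| < c]] `<=` G.
Notation s := (a / c).
Notation T := (section_map s c q e1 e2).

Lemma section_diff0 (v : R * R) :
  diff0 T v = (c * (1 - s ^+ 2)) *: (v.1 *: e1 + v.2 *: e2).
Proof.
have disk0 := @unit_disk0 R.
have Tn : {near (0 : R * R), plane_map q (c *: e1) (c *: e2) (mobius_re s) (mobius_im s) =1 T}.
  by apply: filterS (unit_disk_nbhs disk0) => z z1; rewrite section_mapE.
have [_ dE] := near_eq_is_diff Tn (is_diff_plane_map q (c *: e1) (c *: e2) (mobius_hol sc01 disk0)).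
rewrite /diff0 dE mobius_re'0 mobius_im'0 !mul0r subr0 add0r scalerDr !scalerA.
by rewrite -!mulrA [_ * c]mulrC [v.2 * c]mulrC !mulrA ![_ * c]mulrC.
Qed.

Lemma section_harmonic : harmonic_on_disk T.
Proof.
apply: (@harmonic_on_disk_ext _ _ (plane_map q (c *: e1) (c *: e2) (mobius_re s) (mobius_im s))).
  by move=> z z1; rewrite section_mapE.
apply: harmonic_plane_map => z z1; have [h2 c1 c2] := mobius_hol2 sc01 z1.
by split; [exact: mobius_hol|exact: h2|exact: c1|exact: c2].
Qed.

Lemma section_rate_gt0 : 0 < c * (1 - s ^+ 2).
Proof. by rewrite mulr_gt0//; case/andP: sc01 => ? ?; nra. Qed.

(** The values lie in the section because the automorphism maps the disk into
    itself; conformality at the origin holds because the differential is a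
    multiple of the isometry given by the orthonormal basis. *)
Lemma section_disk_class : disk_class G p Lam T.
Proof.
have [h1 h2 h12 LamE] := e_basis.
have [cT oT rT] := diff0_conformal Hdot h1 h2 h12 section_rate_gt0 section_diff0.
split => //; first exact: section_harmonic; last by rewrite rT LamE.
  move=> z z1; apply: G_section; rewrite section_mapE// /plane_map.
  exists (mobius_re s z *: (c *: e1) + mobius_im s z *: (c *: e2)); last by rewrite addrA.
  rewrite !scalerA; split; first by rewrite LamE; eexists; eexists.
  rewrite (norm_orthonormal Hdot)// ![_ * c]mulrC.
  rewrite (eucl_normZ (mobius_re s z, mobius_im s z)) ?(ltW c_gt0)//.
  rewrite gtr_pMr// /eucl_norm /= -sqrtr1 ltr_sqrt//.
  exact: mobius_lt1.
have disk0 := @unit_disk0 R.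
rewrite section_mapE// /plane_map mobius_re0 mobius_im0 scale0r addr0 scalerA divfK ?gt_eqF//.
by rewrite pE addrC.
Qed.

Lemma opnorm_section : opnorm (diff0 T) = c * (1 - s ^+ 2).
Proof.
have [h1 h2 h12 LamE] := e_basis.
by have [] := diff0_conformal Hdot h1 h2 h12 section_rate_gt0 section_diff0.
Qed.

End SectionDisk.

(** * Normalization and dilation of a map of the class *)

Section Normalization.
Context (R : realType) (H : normedModType R) (dot : {dot H for idfun}).
Hypothesis Hdot : norm_from_dot dot.
Variables (G : set H) (p : H) (Lam : set H) (e1 e2 : H).
Hypothesis e_basis : orthonormal_basis dot Lam e1 e2.

Let disk0 := @unit_disk0 R.

(** If the columns of a two by two matrix are orthonormal then so are its rows:
    the second column is the first one turned by a right angle, up to the sign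
    [d], the determinant. *)
Lemma orthogonal_transpose (x1 y1 x2 y2 : R) :
  x1 ^+ 2 + y1 ^+ 2 = 1 -> x2 ^+ 2 + y2 ^+ 2 = 1 -> x1 * x2 + y1 * y2 = 0 ->
  [/\ x1 ^+ 2 + x2 ^+ 2 = 1, y1 ^+ 2 + y2 ^+ 2 = 1 & x1 * y1 + x2 * y2 = 0].
Proof.
move=> n1 n2 o; pose d : R := x1 * y2 - x2 * y1.
have x2E : x2 = - d * y1.
  have -> : - d * y1 = x2 * (x1 ^+ 2 + y1 ^+ 2) - x1 * (x1 * x2 + y1 * y2) by rewrite /d; ring.
  by rewrite n1 o mulr1 mulr0 subr0.
have y2E : y2 = d * x1.
  have -> : d * x1 = y2 * (x1 ^+ 2 + y1 ^+ 2) - y1 * (x1 * x2 + y1 * y2) by rewrite /d; ring.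
  by rewrite n1 o mulr1 mulr0 subr0.
clearbody d; have d2 : d ^+ 2 = 1.
  transitivity (d ^+ 2 * (x1 ^+ 2 + y1 ^+ 2)); first by rewrite n1 mulr1.
  by rewrite -n2 x2E y2E; ring.
split; rewrite ?x2E ?y2E.
- by transitivity (x1 ^+ 2 + d ^+ 2 * y1 ^+ 2); [ring|rewrite d2 mul1r].
- by transitivity (y1 ^+ 2 + d ^+ 2 * x1 ^+ 2); [ring|rewrite d2 mul1r addrC].
- by transitivity (x1 * y1 - d ^+ 2 * (x1 * y1)); [ring|rewrite d2 mul1r subrr].
Qed.

Lemma diff0_lin2 (F : R * R -> H) al be ga de (v : R * R) : differentiable F 0 ->
  diff0 (F \o lin2 al be ga de) v = diff0 F (lin2 al be ga de v).
Proof.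
move=> dF; have L0 : lin2 al be ga de 0 = 0 by rewrite /lin2 /= !mulr0 addr0.
have [D1 D2] := @derive_lin2 _ _ F al be ga de 0 v (eq_ind_r (fun z => differentiable F z) dF L0).
by move: D2; rewrite L0 /diff0 !deriveE.
Qed.

(** A conformal differential with image spanned by [e1] and [e2] is a multiple of
    an orthogonal matrix; precomposing with the transposed matrix, a rotation or
    a reflection of the disk, puts it in normalized position. *)
Lemma disk_class_normalize (F : R * R -> H) : disk_class G p Lam F ->
  exists F1 : R * R -> H,
   [/\ harmonic_on_disk F1, forall z, unit_disk z -> G (F1 z), F1 0 = p, 0 < opnorm (diff0 F) &
     forall v, diff0 F1 v = opnorm (diff0 F) *: (v.1 *: e1 + v.2 *: e2)].
Proof.
move=> [hF GF F0 [lam lam0 cF] rF]; rewrite (opnorm_conformal lam0 cF).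
have [h1 h2 h12 LamE] := e_basis.
have dF : differentiable F 0 by have [] := hF.1 _ disk0.
have coord (v : R * R) : exists x y : R, diff0 F v = lam *: (x *: e1 + y *: e2).
  have : Lam (diff0 F v) by rewrite -rF; exists v.
  rewrite LamE => -[x [y ->]]; exists (lam^-1 * x), (lam^-1 * y).
  by rewrite scalerDr !scalerA !mulrA divff ?gt_eqF// !mul1r.
have [x1 [y1 E1]] := coord (1, 0); have [x2 [y2 E2]] := coord (0, 1).
have dFE (v : R * R) : diff0 F v =
    lam *: ((x1 * v.1 + x2 * v.2) *: e1 + (y1 * v.1 + y2 * v.2) *: e2).
  have -> : diff0 F v = v.1 *: diff0 F (1, 0) + v.2 *: diff0 F (0, 1).
    by rewrite /diff0 (diff_coordE v dF) !deriveE.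
  rewrite E1 E2 !scalerA ![v.1 * _]mulrC ![v.2 * _]mulrC -!scalerA -scalerDr; congr (_ *: _).
  by rewrite !scalerDr !scalerA addrACA -!scalerDl ![v.1 * _]mulrC ![v.2 * _]mulrC.
have isom (v : R * R) : (x1 * v.1 + x2 * v.2) ^+ 2 + (y1 * v.1 + y2 * v.2) ^+ 2 = v.1 ^+ 2 + v.2 ^+ 2.
  have := cF v; rewrite dFE normrZ gtr0_norm// (norm_orthonormal Hdot)//.
  move=> /(mulfI (lt0r_neq0 lam0)); rewrite /eucl_norm /= => /(congr1 (fun x => x ^+ 2)).
  by rewrite !sqr_sqrtr// addr_ge0// sqr_ge0.
have n1 : x1 ^+ 2 + y1 ^+ 2 = 1.
  by have := isom (1, 0); rewrite /= !mulr1 !mulr0 !addr0 expr1n expr0n addr0.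
have n2 : x2 ^+ 2 + y2 ^+ 2 = 1.
  by have := isom (0, 1); rewrite /= !mulr1 !mulr0 !add0r expr1n expr0n add0r.
have o : x1 * x2 + y1 * y2 = 0 by have := isom (1, 1); rewrite /= !mulr1; nra.
have [m1 m2 o'] := orthogonal_transpose n1 n2 o.
pose L := lin2 x1 y1 x2 y2.
have L_norm (z : R * R) : (L z).1 ^+ 2 + (L z).2 ^+ 2 = z.1 ^+ 2 + z.2 ^+ 2.
  transitivity ((x1 ^+ 2 + x2 ^+ 2) * z.1 ^+ 2 + (y1 ^+ 2 + y2 ^+ 2) * z.2 ^+ 2 +
     2 * (x1 * y1 + x2 * y2) * (z.1 * z.2)); first by rewrite /L /lin2 /=; ring.
  by rewrite m1 m2 o' !mul1r mulr0 mul0r addr0.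
have L_disk z : unit_disk z -> unit_disk (L z) by rewrite /unit_disk /= L_norm.
exists (F \o L); split => //.
- by apply: harmonic_lin2 => //; rewrite n1 n2.
- by move=> z z1; exact/GF/L_disk.
- by rewrite /= /L /lin2 /= !mulr0 addr0.
move=> v; rewrite diff0_lin2// dFE; congr (_ *: (_ *: e1 + _ *: e2)); rewrite /lin2 /=.
  transitivity ((x1 ^+ 2 + x2 ^+ 2) * v.1 + (x1 * y1 + x2 * y2) * v.2); first by ring.
  by rewrite m1 o' mul1r mul0r addr0.
transitivity ((y1 ^+ 2 + y2 ^+ 2) * v.2 + (x1 * y1 + x2 * y2) * v.1); first by ring.
by rewrite m2 o' mul1r mul0r addr0.
Qed.

(** Dilation provides the boundary function at the price of a factor [rho] on the
    differential. *)
Lemma dilation_normalized (F : R * R -> H) (lam rho : R) : bounded_set G ->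
  harmonic_on_disk F -> (forall z, unit_disk z -> G (F z)) -> F 0 = p -> 0 < lam ->
  (forall v, diff0 F v = lam *: (v.1 *: e1 + v.2 *: e2)) -> 0 < rho < 1 ->
  exists Fr Phi, [/\ normalized_class G p Lam e1 e2 Fr, boundary_function Fr Phi &
    opnorm (diff0 Fr) = rho * lam].
Proof.
move=> [M [_ GM]] hF GF F0 lam0 dFE /andP[rho0 rho1].
have [h1 h2 h12 LamE] := e_basis.
have dF : differentiable F 0 by have [] := hF.1 _ disk0.
pose L := lin2 rho 0 0 rho.
have L_disk (z : R * R) : unit_disk z -> unit_disk (L z).
  rewrite /unit_disk /L /lin2 /= !mul0r addr0 add0r !exprMn -mulrDr => z1.
  have := sqr_ge0 z.1; have := sqr_ge0 z.2; move: z1.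
  move: (z.1 ^+ 2) (z.2 ^+ 2) => x y xy y0 x0.
  have r2 : rho ^+ 2 <= 1 by nra.
  by apply: le_lt_trans xy; rewrite ler_piMl// addr_ge0.
have hFr : harmonic_on_disk (F \o L).
  by apply: harmonic_lin2 => //; rewrite ?expr0n ?mulr0 ?mul0r ?addr0 ?add0r.
have dFrE v : diff0 (F \o L) v = (rho * lam) *: (v.1 *: e1 + v.2 *: e2).
  rewrite diff0_lin2// dFE /lin2 /= !mul0r addr0 add0r -!scalerA -scalerDr !scalerA.
  by rewrite mulrC.
have rl0 : 0 < rho * lam by rewrite mulr_gt0.
have [cFr oFr rFr] := diff0_conformal Hdot h1 h2 h12 rl0 dFrE.
have dFr0 : differentiable (F \o L) 0 by have [] := hFr.1 _ disk0.
exists (F \o L), (F \o L); split; [split| |] => //; rewrite ?oFr//.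
- split => //; last by rewrite rFr LamE.
    by move=> z z1; exact/GF/L_disk.
  by rewrite /= /L /lin2 /= !mulr0 addr0.
- by rewrite /partial_x deriveE// -/(diff0 _ _) dFrE /= scale1r scale0r addr0.
- by rewrite /partial_y deriveE// -/(diff0 _ _) dFrE /= scale1r scale0r add0r.
apply: (boundary_function_dilation Hdot (M := M + 1)) => //; first by rewrite ltW.
by move=> z z1; apply: (GM (M + 1)); [rewrite ltrDl|exact: GF].
Qed.

End Normalization.

(** * The extremality criterion *)

Lemma shrink_above (R : realType) (tau lam : R) : 0 < tau -> tau < lam ->
  exists2 rho : R, 0 < rho < 1 & tau < rho * lam.
Proof.
move=> tau0 lt; have lam0 : 0 < lam := lt_trans tau0 lt.
exists ((1 + tau / lam) / 2).
  have : 0 < tau / lam < 1 by rewrite divr_gt0//= ltr_pdivrMr// mul1r.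
  by move=> /andP[? ?]; apply/andP; split; lra.
have -> : (1 + tau / lam) / 2 * lam = (lam + tau) / 2 by field; rewrite gt_eqF.
by lra.
Qed.

Lemma shrink_close (R : realType) (c tau e : R) : 0 < c -> 0 < tau -> 0 < e ->
  exists2 rho : R, 0 < rho < 1 & c * (tau - rho * tau) <= e.
Proof.
move=> c0 tau0 e0; pose d := Num.min 2^-1 (e / (c * tau)).
have ct0 : 0 < c * tau by rewrite mulr_gt0.
have d0 : 0 < d by rewrite lt_min invr_gt0 ltr0n divr_gt0.
have d2 : d <= 2^-1 by rewrite ge_min lexx.
have de : d * (c * tau) <= e by rewrite -ler_pdivlMr// ge_min lexx orbT.
exists (1 - d); first by apply/andP; split; lra.
by apply: le_trans de; rewrite le_eqVlt; apply/orP; left; apply/eqP; ring.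
Qed.

Lemma ler_gap (R : realType) (x y c l t : R) : 0 < c -> x - y = c * (l - t) ->
  (l <= t <-> x <= y).
Proof.
by move=> c0 g; split=> h; [rewrite -subr_le0 g pmulr_rle0// subr_le0|
     rewrite -subr_le0 -(pmulr_rle0 _ c0) -g subr_le0].
Qed.

Lemma ler_add_gap (R : realType) (x y c l t e : R) :
  x - y = c * (l - t) -> c * (t - l) <= e -> y <= x + e.
Proof.
move=> g close; rewrite -lerBlDl; apply: le_trans close.
by rewrite -opprB g -mulrN opprB.
Qed.

(** The left-hand side is the value of the functional on a normalized map with
    [|dF_0| = l], as given by [functional_IE], minus [(1 + s^2) R^2]. *)
Lemma gap_formula (R : realType) (s c a b l : R) : a = s * c ->
  (1 + s ^+ 2) * b ^+ 2 + s * 0 + (2 * s * c * a + (1 + s ^+ 2) * c * (l / 2) +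
    (1 - s ^+ 2) * c * (l / 2)) - (1 + s ^+ 2) * (c ^+ 2 + b ^+ 2) =
  c * (l - c * (1 - s ^+ 2)).
Proof. by move=> ->; field. Qed.

Lemma disk_class_le_max (R : realType) (H : normedModType R) (G : set H) (p : H)
    (Lam : set H) (F : R * R -> H) : disk_class G p Lam F ->
  ((opnorm (diff0 F))%:E <= max_diff G p Lam)%E.
Proof. by move=> FG; apply: ereal_sup_ubound; exists F. Qed.

Unset Implicit Arguments.

Theorem corollary4p3 (R : realType) (H : completeNormedModType R)
  (dot : {dot H for idfun}) (Hdot : norm_from_dot dot)
  (G : set H) (G_open : open G) (G_connected : connected G)
  (G_bounded : bounded_set G)
  (p : H) (Gp : G p)
  (Lam : set H) (Lam_dim2 : two_dim_subspace Lam)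
  (pLam pperp : H) (p_split : p = pLam + pperp) (pLam_in : Lam pLam)
  (pperp_orth : forall v, Lam v -> dot pperp v = 0)
  (a b : R) (a_def : a = `|pLam|) (b_def : b = `|pperp|)
  (e1 e2 : H) (e_basis : orthonormal_basis dot Lam e1 e2)
  (pLam_e1 : pLam = a *: e1)
  (c : R) (c_gt0 : 0 < c)
  (G_section : G `&` [set p + v | v in Lam] =
     [set pperp + v | v in [set v | Lam v /\ `|v| < c]])
  (s R2 : R) (s_def : s = a / c) (R2_def : R2 = c ^+ 2 + b ^+ 2)
  (T : R * R -> H) (T_def : T = section_map s c pperp e1 e2) :
  let I := functional_I dot s c pperp e1 e2 in
  [/\ (forall F Phi, normalized_class G p Lam e1 e2 F ->
         boundary_function F Phi ->
         I Phi - (1 + s ^+ 2) * R2 =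
           c * (opnorm (diff0 F) - opnorm (diff0 T))),
      (forall F Phi, normalized_class G p Lam e1 e2 F ->
         boundary_function F Phi ->
         (opnorm (diff0 F) <= opnorm (diff0 T) <->
          I Phi <= (1 + s ^+ 2) * R2)),
      (extremal_disk G p Lam T <->
         sigma_G dot s c pperp G p Lam e1 e2 = ((1 + s ^+ 2) * R2)%:E) &
      (extremal_disk G p Lam T <->
         (forall F Phi, normalized_class G p Lam e1 e2 F ->
            boundary_function F Phi -> I Phi <= (1 + s ^+ 2) * R2))].
Proof.
have [h1 h2 h12 LamE] := e_basis.
have Lam_e1 : Lam e1 by rewrite LamE; exists 1, 0; rewrite scale1r scale0r addr0.
have Lam0 : Lam 0 by rewrite LamE; exists 0, 0; rewrite !scale0r addr0.
have pE : p = a *: e1 + pperp by rewrite p_split pLam_e1.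
have a_ge0 : 0 <= a by rewrite a_def.
have a_lt_c : a < c.
  have : (G `&` [set p + v | v in Lam]) p by split=> //; exists 0; rewrite ?addr0.
  rewrite G_section => -[v [_ vc]] /eqP; rewrite p_split addrC => /eqP /addIr vE.
  by rewrite a_def -vE.
have s01 : 0 <= a / c < 1 by rewrite divr_ge0 ?(ltW c_gt0)//= ltr_pdivrMr// mul1r.
have G_sub : [set pperp + v | v in [set v | Lam v /\ `|v| < c]] `<=` G.
  by rewrite -G_section => z [].
have TG : disk_class G p Lam T.
  by rewrite T_def s_def; exact: (section_disk_class Hdot e_basis pE c_gt0 s01 G_sub).
have oT : opnorm (diff0 T) = c * (1 - s ^+ 2).
  by rewrite T_def s_def; exact: (opnorm_section Hdot _ e_basis).
have dT v : diff0 T v = opnorm (diff0 T) *: (v.1 *: e1 + v.2 *: e2).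
  by rewrite oT T_def s_def; exact: section_diff0.
have T_gt0 : 0 < opnorm (diff0 T) by rewrite oT s_def; exact: section_rate_gt0.
have sc : a = s * c by rewrite s_def divfK// gt_eqF.
have q_e1 : dot pperp e1 = 0 by exact: pperp_orth.
have q_q : dot pperp pperp = b ^+ 2 by rewrite (dotxx Hdot) b_def.
set I := functional_I dot s c pperp e1 e2.
have gap F Phi : normalized_class G p Lam e1 e2 F -> boundary_function F Phi ->
    I Phi - (1 + s ^+ 2) * R2 = c * (opnorm (diff0 F) - opnorm (diff0 T)).
  move=> [[hF _ F0 _ _] _ Fx Fy] FPhi.
  have dF : differentiable F 0.
    by have [] := hF.1 0 (unit_disk0 R).
  rewrite /I (functional_IE Hdot _ _ _ _ FPhi dF) ?s_def// -s_def.
  have p_q : dot (F 0) pperp = b ^+ 2.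
    by rewrite F0 pE dotDl dotZl (dotC dot e1) q_e1 mulr0 add0r.
  have p_e1 : dot (F 0) e1 = a by rewrite F0 pE dotDl dotZl h1 q_e1 mulr1 addr0.
  have x_q : dot (partial_x F 0) pperp = 0 by rewrite Fx dotZl (dotC dot e1) q_e1 mulr0.
  have x_e1 : dot (partial_x F 0) e1 = opnorm (diff0 F) by rewrite Fx dotZl h1 mulr1.
  have y_e2 : dot (partial_y F 0) e2 = opnorm (diff0 F) by rewrite Fy dotZl h2 mulr1.
  rewrite p_q p_e1 x_q x_e1 y_e2 oT R2_def; exact: gap_formula.
have iff_le F Phi (nF : normalized_class G p Lam e1 e2 F) (FPhi : boundary_function F Phi) :
    opnorm (diff0 F) <= opnorm (diff0 T) <-> I Phi <= (1 + s ^+ 2) * R2.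
  exact: (ler_gap c_gt0 (gap F Phi nF FPhi)).
have ext_iff : extremal_disk G p Lam T <-> (forall F Phi, normalized_class G p Lam e1 e2 F ->
    boundary_function F Phi -> I Phi <= (1 + s ^+ 2) * R2).
  split=> [[_ Tmax] F Phi nF FPhi|IB].
    have le : ((opnorm (diff0 F))%:E <= max_diff G p Lam)%E.
      by case: nF => FG _ _ _; exact: disk_class_le_max FG.
    rewrite -Tmax lee_fin in le.
    exact: (proj1 (iff_le F Phi nF FPhi) le).
  split; first exact: TG.
  apply/eqP; rewrite eq_le (disk_class_le_max TG) andTb.
  apply: ge_ereal_sup => _ [F FG <-]; rewrite lee_fin.
  have [F1 [hF1 GF1 F10 lam0 dF1]] := disk_class_normalize Hdot e_basis FG.
  rewrite leNgt; apply/negP => lt; have [rho rho01 lt'] := shrink_above T_gt0 lt.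
  have [Fr [Phi [nFr FrPhi oFr]]] :=
    dilation_normalized Hdot e_basis G_bounded hF1 GF1 F10 lam0 dF1 rho01.
  have le := proj2 (iff_le Fr Phi nFr FrPhi) (IB Fr Phi nFr FrPhi).
  by rewrite oFr leNgt lt' in le.
have sigma_ge : (((1 + s ^+ 2) * R2)%:E <= sigma_G dot s c pperp G p Lam e1 e2)%E.
  apply/lee_addgt0Pr => e e0.
  have [hT GT T0 _ _] := TG.
  have [rho rho01 close] := shrink_close c_gt0 T_gt0 e0.
  have [Fr [Phi [nFr FrPhi oFr]]] :=
    dilation_normalized Hdot e_basis G_bounded hT GT T0 T_gt0 dT rho01.
  have Ile : ((I Phi)%:E <= sigma_G dot s c pperp G p Lam e1 e2)%E.
    by apply: ereal_sup_ubound; exists Fr, Phi; split.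
  have g := gap Fr Phi nFr FrPhi; rewrite oFr in g.
  apply: (@le_trans _ _ ((I Phi)%:E + e%:E)%E); last by rewrite leeD2r.
  by rewrite -EFinD lee_fin; exact: ler_add_gap g close.
split; [exact: gap|exact: iff_le| |exact: ext_iff].
split=> [ext|sig].
  apply/eqP; rewrite eq_le sigma_ge andbT.
  apply: ge_ereal_sup => _ [F [Phi [nF FPhi ->]]]; rewrite lee_fin.
  exact: (proj1 ext_iff ext F Phi nF FPhi).
apply: (proj2 ext_iff) => F Phi nF FPhi; rewrite -lee_fin -sig.
by apply: ereal_sup_ubound; exists F, Phi; split.
Qed.
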